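(* Let $\Gamma=\sum_{t=1}^{M}\Gamma_t$ be a holomorphic correspondence on $\widehat{\mathbb{C}}$ with space of permissible forward paths of infinite length $\mathscr{P}^{\Gamma}(\widehat{\mathbb{C}})$, and let $\sigma^{\Gamma}$ be the left shift map on $\mathscr{P}^{\Gamma}(\widehat{\mathbb{C}})$. Let $(\nu,\mu)$ be an ordered pair of measures with $\nu\in\mathscr{S}^{\Gamma}$ and $\mu\in\mathscr{M}_{\sigma^{\Gamma}}(\mathscr{P}^{\Gamma}(\widehat{\mathbb{C}}))$ satisfying $\nu=(\Pi_0)_*\mu$. Then $$h_{(\nu,\mu)}(\Gamma)=h_{\mu}(\sigma^{\Gamma}),$$ where $h_{(\nu,\mu)}(\Gamma)$ is the intermediate entropy of $\Gamma$ with respect to $(\nu,\mu)$ and $h_\mu(\sigma^{\Gamma})$ is the usual measure-theoretic (Kolmogorov–Sinai) entropy of $\sigma^{\Gamma}$ with respect to $\mu$.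
   Context: Holomorphic correspondence: $\Gamma\subseteq\widehat{\mathbb{C}}\times\widehat{\mathbb{C}}$ is a formal linear combination $\Gamma=\sum_{t=1}^{M}\Gamma_t$ of irreducible complex-analytic subvarieties $\Gamma_t$ of $\widehat{\mathbb{C}}\times\widehat{\mathbb{C}}$, repeated according to their multiplicities, such that, with $\pi_i$ the projection onto the $i$-th coordinate ($i=1,2$): (1) $\pi_i|_{\Gamma_t}$ is surjective for $i=1,2$ and every $1\le t\le M$; (2) for every $t$ and every generic $x_0\in\widehat{\mathbb{C}}$ the sets $\pi_1(\pi_2^{-1}(\{x_0\})\cap\Gamma_t)$ and $\pi_2(\pi_1^{-1}(\{x_0\})\cap\Gamma_t)$ are finite. Path space: $\mathscr{P}^{\Gamma}(\widehat{\mathbb{C}})$ is the set of all $(x_0,x_1,x_2,\dots;\alpha_1,\alpha_2,\dots)$ with $x_r\in\widehat{\mathbb{C}}$, $\alpha_r\in\{1,\dots,M\}$ and $(x_{r-1},x_r)\in\Gamma_{\alpha_r}$ for all $r\ge 1$. It is a compact metric space with the metric $$\Delta\big((x_r;\alpha_r),(y_r;\beta_r)\big)=\max\Big\{\sup_{r\ge 0}2^{-r}d_{\widehat{\mathbb{C}}}(x_r,y_r),\ \sup_{r\ge1}2^{-r}(1-\delta_{(\alpha_r,\beta_r)})\Big\},$$ where $d_{\widehat{\mathbb{C}}}$ is the spherical metric and $\delta_{(p,q)}$ the Kronecker delta. The shift is $\sigma^{\Gamma}(x_0,x_1,\dots;\alpha_1,\alpha_2,\dots)=(x_1,x_2,\dots;\alpha_2,\alpha_3,\dots)$,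 which is continuous. Projections: $\Pi_r(x_0,x_1,\dots;\alpha_1,\dots)=x_r$ for $r\ge0$ and $\mathrm{Proj}_r(x_0,x_1,\dots;\alpha_1,\dots)=\alpha_r$ for $r\ge1$. Measures: $\mathscr{M}(\widehat{\mathbb{C}})$ is the set of Borel probability measures on $\widehat{\mathbb{C}}$; $\mathscr{M}_{\sigma^{\Gamma}}(\mathscr{P}^{\Gamma}(\widehat{\mathbb{C}}))$ is the set of $\sigma^{\Gamma}$-invariant Borel probability measures on $\mathscr{P}^{\Gamma}(\widehat{\mathbb{C}})$; $((\Pi_0)_*\mu)(B)=\mu(\Pi_0^{-1}B)$ for Borel $B\subset\widehat{\mathbb{C}}$; and $\mathscr{S}^{\Gamma}=\{\nu\in\mathscr{M}(\widehat{\mathbb{C}}):\nu=(\Pi_0)_*\mu\text{ for some }\mu\in\mathscr{M}_{\sigma^{\Gamma}}(\mathscr{P}^{\Gamma}(\widehat{\mathbb{C}}))\}$. Intermediate entropy: for a finite measurable collection $\mathcal{A}=\{A_1,\dots,A_s\}$ of subsets of $\mathscr{P}^{\Gamma}(\widehat{\mathbb{C}})$ put $H_\mu(\mathcal{A})=-\sum_i\mu(A_i)\log\mu(A_i)$ (with $0\log0=0$), and $\mathcal{A}\vee\mathcal{B}=\{A\cap B:A\in\mathcal{A},B\in\mathcal{B}\}$. For a finite $\nu$-measurable partition $\mathcal{Q}=\{Q_1,\dots,Q_s\}$ of $\widehat{\mathbb{C}}$ and $(\nu,\mu)$ with $\nu=(\Pi_0)_*\mu$, $\mu\in\mathscr{M}_{\sigma^{\Gamma}}(\mathscr{P}^{\Gamma}(\widehat{\mathbb{C}}))$,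 define $$H_{(\nu,\mu)}(\mathcal{Q};\Gamma)=\lim_{n\to\infty}\frac1n H_\mu\left(\bigvee_{p=0}^{n-1}\left\{\Pi_p^{-1}(Q_i)\cap\mathrm{Proj}_{p+1}^{-1}(\{t\}):1\le i\le s,\ 1\le t\le M\right\}\right),$$ and $h_{(\nu,\mu)}(\Gamma)=\sup_{\mathcal{Q}}H_{(\nu,\mu)}(\mathcal{Q};\Gamma)$, the supremum over all finite $\nu$-measurable partitions $\mathcal{Q}$ of $\widehat{\mathbb{C}}$. *)

(* Defs.v *)
From HB Require Import structures.
From mathcomp Require Import all_boot all_order all_algebra.
From mathcomp Require Import complex.
From mathcomp Require Import all_classical all_reals all_analysis.

Set Implicit Arguments.
Unset Strict Implicit.
Unset Printing Implicit Defensive.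

Import Order.TTheory GRing.Theory Num.Theory.
Import numFieldNormedType.Exports.
Local Open Scope classical_set_scope.
Local Open Scope ring_scope.

(** * The Riemann sphere *)

(* [R[i]^o] is the type of complex numbers seen as a normed space over itself;
   [None] is the point at infinity. *)
Definition sphere (R : realType) : Type := one_point_compactification R[i]^o.

HB.instance Definition _ (R : realType) := Topological.on (sphere R).
HB.instance Definition _ (R : realType) := Pointed.on (sphere R).

(* Half the Euclidean distance between the images of [x] and [y] on the unit
   sphere of [R^3] under inverse stereographic projection. *)
Definition half_chord (R : realType) (x y : sphere R) : R :=
  let nrm (z : R[i]) := Num.sqrt (1 + Normc.normc z ^+ 2) in
  match x, y with
  | Some z, Some w => Normc.normc (z - w : R[i]) / (nrm z * nrm w)
  | Some z, None | None, Some z => (nrm z)^-1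
  | None, None => 0
  end.

(* Great-circle distance on the unit sphere. *)
Definition sphere_dist (R : realType) (x y : sphere R) : R :=
  2 * asin (half_chord x y).

HB.instance Definition _ (R : realType) :=
  Measurable.copy (sphere R) (g_sigma_algebraType (@open (sphere R))).

(** * Complex-analytic subvarieties *)

(* [differentiable] over the scalars [R[i]] is complex Frechet
   differentiability, so [f i] below is holomorphic on the open set [U]. *)
Definition analytic_set (R : realType) (V : normedModType R[i]) (A : set V) :
    Prop :=
  forall p : V, exists U : set V, open_nbhs p U /\
    exists (k : nat) (f : 'I_k -> V -> R[i]^o),
      (forall i x, U x -> differentiable (f i) x) /\
      (forall x, U x -> (A x <-> forall i, f i x = 0)).

(* The two standard holomorphic parametrizations of the sphere, by [z] and by
   [1 / z]; their images are open and cover it. *)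
Definition chart (R : realType) (b : bool) (z : R[i]^o) : sphere R :=
  if b then (if z == 0 then None else Some z^-1) else Some z.

Definition chart2 (R : realType) (b c : bool) (z : R[i]^o * R[i]^o) :
  sphere R * sphere R := (chart b z.1, chart c z.2).

Definition sphere_analytic (R : realType) (E : set (sphere R)) : Prop :=
  forall b, analytic_set (chart b @^-1` E).

Definition sphere2_analytic (R : realType) (A : set (sphere R * sphere R)) :
    Prop :=
  forall b c, analytic_set (chart2 b c @^-1` A).

Definition irreducible_subvariety (R : realType)
    (A : set (sphere R * sphere R)) : Prop :=
  [/\ sphere2_analytic A,
      A !=set0 &
      forall A1 A2, sphere2_analytic A1 -> sphere2_analytic A2 ->
        A = A1 `|` A2 -> A = A1 \/ A = A2].

(* A property holds for generic points if it holds off a proper analytic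
   subset. *)
Definition generic (R : realType) (P : sphere R -> Prop) : Prop :=
  exists E : set (sphere R),
    [/\ sphere_analytic E, E <> setT & forall x, ~ E x -> P x].

(** * Holomorphic correspondences *)

(* The formal sum of the [component t]; a component of multiplicity [m] occurs
   [m] times in the family. *)
Record correspondence (R : realType) (M : nat) := Correspondence {
  component :> 'I_M -> set (sphere R * sphere R);
  correspondence_gt0 : (0 < M)%N;
  component_irreducible : forall t, irreducible_subvariety (component t);
  component_surj1 : forall t, set_surj (component t) setT fst;
  component_surj2 : forall t, set_surj (component t) setT snd;
  component_finite : forall t, generic (fun x0 =>
    finite_set (fst @` (snd @^-1` [set x0] `&` component t)) /\
    finite_set (snd @` (fst @^-1` [set x0] `&` component t)))
}.

(** * The path space and the shift *)

(* [path_label x r] is the index alpha_(r+1) of the step from x_r to x_(r+1). *)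
Record path_space (R : realType) (M : nat) (Gamma : correspondence R M) :=
  PathSpace {
    path_point : nat -> sphere R;
    path_label : nat -> 'I_M;
    path_step : forall r, Gamma (path_label r) (path_point r, path_point r.+1)
  }.

Definition Pi (R : realType) (M : nat) (Gamma : correspondence R M) (r : nat)
  (x : path_space Gamma) : sphere R := path_point x r.

(* Meaningful for [r >= 1]. *)
Definition Proj (R : realType) (M : nat) (Gamma : correspondence R M) (r : nat)
  (x : path_space Gamma) : 'I_M := path_label x r.-1.

Definition path_shift (R : realType) (M : nat) (Gamma : correspondence R M)
    (x : path_space Gamma) : path_space Gamma :=
  @PathSpace R M Gamma (fun r => path_point x r.+1) (fun r => path_label x r.+1)
    (fun r => path_step x r.+1).

Definition path_dist (R : realType) (M : nat) (Gamma : correspondence R M)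
    (x y : path_space Gamma) : R :=
  Num.max
    (sup [set 2 ^- r * sphere_dist (Pi r x) (Pi r y) | r in [set: nat]])
    (sup [set 2 ^- r * (Proj r x != Proj r y)%:R
         | r in [set r | (1 <= r)%N]]).

Definition path_open (R : realType) (M : nat) (Gamma : correspondence R M) :
    set (set (path_space Gamma)) :=
  [set U | forall x, U x -> exists2 e : R, 0 < e &
                     forall y, path_dist x y < e -> U y].

(* Measurable types are required to be inhabited. *)
Lemma path_space_inhabited (R : realType) (M : nat)
    (Gamma : correspondence R M) : exists _ : path_space Gamma, True.
Proof.
pose t0 := Ordinal (correspondence_gt0 Gamma).
have /choice[s hs] : forall x, exists y, Gamma t0 (x, y).
  by move=> x; have [[x' y] ? /= <-] := @component_surj1 _ _ Gamma t0 x I; exists y.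
by exists (@PathSpace _ _ Gamma (fun r => iter r s None) (fun=> t0)
             (fun r => hs (iter r s None))).
Qed.

HB.instance Definition _ (R : realType) (M : nat) (Gamma : correspondence R M)
  := gen_eqMixin (path_space Gamma).
HB.instance Definition _ (R : realType) (M : nat) (Gamma : correspondence R M)
  := gen_choiceMixin (path_space Gamma).
HB.instance Definition _ (R : realType) (M : nat) (Gamma : correspondence R M)
  := isPointed.Build (path_space Gamma)
       (projT1 (cid (path_space_inhabited Gamma))).

HB.instance Definition _ (R : realType) (M : nat) (Gamma : correspondence R M)
  := Measurable.copy (path_space Gamma)
       (g_sigma_algebraType (@path_open R M Gamma)).

(** * Measures *)

Definition invariant_measure (R : realType) (d : measure_display)
    (T : measurableType d) (f : T -> T) (mu : probability T R) : Prop :=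
  forall A, measurable A -> mu (f @^-1` A) = mu A.

Definition projects_to (R : realType) (M : nat) (Gamma : correspondence R M)
    (mu : probability (path_space Gamma) R)
    (nu : probability (sphere R) R) : Prop :=
  forall B : set (sphere R), measurable B ->
    nu B = pushforward mu (@Pi R M Gamma 0) B.

Definition S_Gamma (R : realType) (M : nat) (Gamma : correspondence R M) :
    set (probability (sphere R) R) :=
  [set nu | exists mu : probability (path_space Gamma) R,
     invariant_measure (@path_shift R M Gamma) mu /\ projects_to mu nu].

(** * Entropy *)

(* Finite collections are indexed families. The families below are partitions,
   in which only the empty set can be repeated, so that repetitions do not
   contribute to the entropy. *)
Definition finite_partition (T I : Type) (meas : set (set T))
    (A : I -> set T) : Prop :=
  [/\ forall i, meas (A i), trivIset setT A & \bigcup_i A i = setT].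

Definition entropy (R : realType) (T : Type) (I : finType)
    (mu : set T -> \bar R) (A : I -> set T) : R :=
  - \sum_(i : I) fine (mu (A i)) * ln (fine (mu (A i))).

(* The join of the [n] collections [A 0], ..., [A n.-1]. *)
Definition iter_join (T : Type) (I : finType) (n : nat)
    (A : nat -> I -> set T) (f : {ffun 'I_n -> I}) : set T :=
  \bigcap_(p in [set: 'I_n]) A p (f p).

Definition entropy_rate (R : realType) (T : Type) (I : finType)
    (mu : set T -> \bar R) (A : nat -> I -> set T) : \bar R :=
  limn (fun n => (n%:R^-1 * entropy mu (@iter_join T I n A))%:E).

(* Kolmogorov-Sinai entropy. *)
Definition ks_entropy (R : realType) (d : measure_display)
    (T : measurableType d) (f : T -> T) (mu : probability T R) : \bar R :=
  ereal_sup [set h | exists (s : nat) (A : 'I_s -> set T),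
    finite_partition measurable A /\
    h = entropy_rate mu (fun p i => iter p f @^-1` A i)].

(* [nu^*.-cara.-measurable] are the nu-measurable sets, i.e. those of the
   completion of the Borel sigma-algebra with respect to [nu]. The sets whose
   measure is taken in the entropies are then only measurable for the
   completion of [mu], which is the restriction of [mu^*]. *)
Definition intermediate_entropy_partition (R : realType) (M : nat)
    (Gamma : correspondence R M) (mu : probability (path_space Gamma) R)
    (s : nat) (Q : 'I_s -> set (sphere R)) : \bar R :=
  entropy_rate (mu^*)%mu
    (fun p (it : 'I_s * 'I_M) =>
       @Pi R M Gamma p @^-1` Q it.1 `&`
       @Proj R M Gamma p.+1 @^-1` [set it.2]).

Definition intermediate_entropy (R : realType) (M : nat)
    (Gamma : correspondence R M) (nu : probability (sphere R) R)
    (mu : probability (path_space Gamma) R) : \bar R :=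
  ereal_sup [set h | exists (s : nat) (Q : 'I_s -> set (sphere R)),
    finite_partition (nu^*)%mu.-cara.-measurable Q /\
    h = intermediate_entropy_partition mu Q].

(* Main.v *)
Require Import Defs.
From mathcomp Require Import all_boot all_order all_algebra.
From mathcomp Require Import complex lra ring.
From mathcomp Require Import all_classical all_reals all_analysis.

(** The theorem holds because, along a path, the position and the label of the
    first step generate the whole Borel sigma-algebra under the shift.

    A finite measurable partition is the family of fibres of a finite-valued
    map [X], so entropies are attached to maps: [map_entropy] of [X],
    conditional entropy as the difference [H(X, Z) - H(Z)], and [rate], the
    limit of the entropies of [n]-step itineraries divided by [n]. All the
    inequalities of entropy theory that are needed follow from two facts: the
    entropy of a function of [Z] is at most that of [Z] ([map_entropy_le]), and
    entropy is submodular ([map_entropy_submodular]). Submodularity makes the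
    increments of the entropies of itineraries decrease, so that the limits
    defining the rates exist ([entropy_rate_is_cvg]).

    For a map [q] from the sphere to a finite set, [first_step q] records
    [q (x_0)] and the first label. Its rate is the quantity of which the
    intermediate entropy is the supremum, except that there [q] may be
    measurable for the completion of [nu] only. Such a [q] agrees with a Borel
    map off a [nu]-null set ([ae_measurable_modification]); by invariance the
    paths that ever visit this set form a null set, so nothing changes
    ([intermediate_entropy_partitionE]). Hence the intermediate entropy is a
    supremum of rates over fewer maps than the Kolmogorov-Sinai entropy, which
    gives one inequality ([intermediate_entropy_le]).

    The other inequality is the Kolmogorov-Sinai generator theorem
    ([rate_le_membership]). If the sets of a family [G] and their preimages
    under the iterates of [f] generate the measurable sets, then every
    measurable set is, up to arbitrarily small measure, determined by the
    visits to finitely many members of [G] during finitely many steps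
    ([measurable_approximable]). For an arbitrary finite-valued [X] this yields
    finitely many members of [G] whose itineraries leave [X] with small
    conditional entropy, and [rate_le] bounds the rate of [X] by the rate of
    the itineraries plus that conditional entropy.

    It remains to see that the cylinders generate the Borel sets of the path
    space ([measurable_generated_cylinder]). The distance of two paths is
    small as soon as finitely many points are close and finitely many labels
    agree, and the point at infinity together with countably many balls suffice
    to test closeness on the sphere ([base_set_small]); thus an open set of
    paths is a countable union of finite intersections of cylinders. *)

Set Implicit Arguments.
Unset Strict Implicit.
Unset Printing Implicit Defensive.

Import Order.TTheory GRing.Theory Num.Theory.
Import numFieldNormedType.Exports.
Local Open Scope classical_set_scope.
Local Open Scope ring_scope.

(** * Entropy of finite-valued maps *)

Definition determines (T I J : Type) (Z : T -> I) (Y : T -> J) : Prop :=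
  forall x y, Z x = Z y -> Y x = Y y.

Definition joint (T I J : Type) (X : T -> I) (Y : T -> J) (x : T) : I * J :=
  (X x, Y x).

Definition block (T : Type) (J : finType) (n : nat) (X : nat -> T -> J) (x : T) :
  {ffun 'I_n -> J} := [ffun p : 'I_n => X p x].

Section finite_entropy.
Context (d : measure_display) (T : measurableType d) (R : realType).
Variable mu : probability T R.

Definition fibre_measurable (I : Type) (X : T -> I) : Prop :=
  forall i, measurable (X @^-1` [set i]).

(** A function of the values of [Z] extends to all of [I], because [T] is
    inhabited. *)
Lemma determines_factor (I J : Type) (Z : T -> I) (Y : T -> J) :
  determines Z Y -> exists g : I -> J, Y = g \o Z.
Proof.
move=> ZY; exists (fun i => Y (xget point (Z @^-1` [set i]))).
by apply/funext => x /=; apply: ZY; case: xgetP => [y _ //|/(_ x)/(_ erefl)].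
Qed.

Lemma fibre_measurable_determines (I : finType) (J : Type)
    (Z : T -> I) (Y : T -> J) :
  determines Z Y -> fibre_measurable Z -> fibre_measurable Y.
Proof.
move=> /determines_factor[g ->] mZ j.
rewrite (_ : _ @^-1` _ = \bigcup_(i in [set i | g i = j]) (Z @^-1` [set i])).
  by apply: fin_bigcup_measurable => // i _; exact: mZ.
by apply/seteqP; split => x /= [] => [<-|i <- -> //]; exists (Z x).
Qed.

Lemma fibre_measurable_joint (I J : Type) (X : T -> I) (Y : T -> J) :
  fibre_measurable X -> fibre_measurable Y -> fibre_measurable (joint X Y).
Proof.
move=> mX mY [i j].
rewrite (_ : _ @^-1` _ = X @^-1` [set i] `&` Y @^-1` [set j]).
  exact: measurableI.
by apply/seteqP; split => x; rewrite /joint /=; [case=> <- <-|case=> -> ->].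
Qed.

Lemma fibre_measurable_block (J : finType) n (X : nat -> T -> J) :
  (forall p, fibre_measurable (X p)) -> fibre_measurable (block n X).
Proof.
move=> mX g.
rewrite (_ : _ @^-1` _ = \bigcap_(p in [set: 'I_n]) (X p @^-1` [set g p])).
  by apply: fin_bigcap_measurable => // p _; exact: mX.
apply/seteqP; split => x /=; first by move=> <- p _ /=; rewrite ffunE.
by move=> h; apply/ffunP => p; rewrite ffunE; exact: h.
Qed.

Definition law (I : Type) (X : T -> I) (i : I) : R :=
  fine (mu (X @^-1` [set i])).

Definition map_entropy (I : finType) (X : T -> I) : R :=
  entropy mu (fun i => X @^-1` [set i]).

(** The chain rule of entropy, taken as definition of the entropy of [X] given
    [Z]. *)
Definition cond_entropy (I J : finType) (X : T -> I) (Z : T -> J) : R :=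
  map_entropy (joint X Z) - map_entropy Z.

Lemma map_entropyE (I : finType) (X : T -> I) :
  map_entropy X = - \sum_i law X i * ln (law X i).
Proof. by []. Qed.

Lemma law_ge0 (I : Type) (X : T -> I) i : 0 <= law X i.
Proof. exact/fine_ge0/measure_ge0. Qed.

Lemma law_comp (I J : finType) (X : T -> I) (g : I -> J) j :
  fibre_measurable X ->
  law (g \o X) j = \sum_(i | g i == j) law X i.
Proof.
move=> mX; rewrite /law.
have -> : (g \o X) @^-1` [set j] =
    \bigcup_(i in [set` [pred i | g i == j]]) (X @^-1` [set i]).
  apply/seteqP; split => x /=; first by move=> <-; exists (X x) => //=; exact: eqxx.
  by case=> i /= /eqP <- ->.
rewrite measure_fin_bigcup//; last first.
  by move=> i k _ _ [x [/= <- <-]].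
rewrite -(bigfs _ (index_enum_uniq I)) => [|i _]; last by rewrite mem_index_enum.
by rewrite -sum_fine// => i _; exact: fin_num_measure.
Qed.

Lemma sum_law (I : finType) (X : T -> I) :
  fibre_measurable X -> \sum_i law X i = 1.
Proof.
move=> mX; have := @law_comp _ _ X (fun=> tt) tt mX.
under eq_bigl do rewrite eqxx.
move=> <-; rewrite /law [X in mu X](_ : _ = setT) ?probability_setT//.
exact/seteqP.
Qed.

Lemma law_le_comp (I J : finType) (X : T -> I) (g : I -> J) i :
  fibre_measurable X -> law X i <= law (g \o X) (g i).
Proof.
move=> mX; rewrite law_comp// (bigD1 i)//= lerDl.
by apply: sumr_ge0 => j _; exact: law_ge0.
Qed.

Lemma sum_law_joint (I J : finType) (X : T -> I) (Z : T -> J) j :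
  fibre_measurable (joint X Z) -> \sum_i law (joint X Z) (i, j) = law Z j.
Proof.
move=> mXZ; have -> : law Z j = law (snd \o joint X Z) j by [].
rewrite law_comp// (reindex_onto (fun i => (i, j)) fst) /=.
  by apply: eq_bigl => i; rewrite !eqxx.
by case=> i k /= /eqP ->.
Qed.

(** Grouping the values of [X] by their image under [g] expresses all the
    entropies of functions of [X] as sums over the same index set, where they
    can be compared term by term. *)
Lemma map_entropy_comp (I J : finType) (X : T -> I) (g : I -> J) :
  fibre_measurable X ->
  map_entropy (g \o X) = - \sum_i law X i * ln (law (g \o X) (g i)).
Proof.
move=> mX; rewrite map_entropyE; congr (- _).
rewrite [RHS](partition_big g xpredT)//=; apply: eq_bigr => j _.
rewrite [X in X * _]law_comp// mulr_suml; apply: eq_bigr => i /eqP <-.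
by [].
Qed.

(** The inequality [ln t <= t - 1] at [t = a b / (c p)]. Summed over the values
    of a triple [(X, Y, Z)], with [p] the probability of a value and [a], [b],
    [c] those of its projections to [(X, Z)], [(Y, Z)], [Z], the left side
    vanishes and the right side is the mutual information of [X] and [Y]
    given [Z]. *)
Lemma mutual_information_term (p a b c : R) :
  0 <= p -> p <= a -> p <= b -> p <= c ->
  p - a * b / c <= p * (ln p + ln c - ln a - ln b).
Proof.
move=> p0 pa pb pc; have [->|pn0] := eqVneq p 0.
  by rewrite mul0r sub0r oppr_le0 divr_ge0 ?mulr_ge0//; lra.
have {}p0 : 0 < p by rewrite lt_def pn0.
have a0 : 0 < a by lra.
have b0 : 0 < b by lra.
have c0 : 0 < c by lra.
have q0 : 0 < a * b / c / p by rewrite !divr_gt0// mulr_gt0.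
have := @le_ln1Dx R (a * b / c / p - 1).
rewrite subrKC ltrBrDl subrr => /(_ q0).
rewrite !ln_div ?lnM ?posrE ?divr_gt0 ?mulr_gt0// => h.
have -> : p - a * b / c = p * - (a * b / c / p - 1) by field; rewrite !lt0r_neq0.
by rewrite ler_pM2l//; lra.
Qed.

(** Nonnegativity of the mutual information of [X] and [Y] given [Z]. *)
Lemma map_entropy_submodular (I J K : finType)
    (X : T -> I) (Y : T -> J) (Z : T -> K) :
  fibre_measurable (joint (joint X Y) Z) ->
  map_entropy (joint (joint X Y) Z) + map_entropy Z <=
  map_entropy (joint X Z) + map_entropy (joint Y Z).
Proof.
set W := joint (joint X Y) Z => mW.
pose gx (w : I * J * K) := (w.1.1, w.2); pose gy (w : I * J * K) := (w.1.2, w.2).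
have mcomp (L : finType) (g : I * J * K -> L) : fibre_measurable (g \o W).
  by apply: fibre_measurable_determines mW => x y e; rewrite /= e.
have eX : map_entropy (joint X Z) = map_entropy (gx \o W) by [].
have eY : map_entropy (joint Y Z) = map_entropy (gy \o W) by [].
have eZ : map_entropy Z = map_entropy (snd \o W) by [].
rewrite eX eY eZ !map_entropy_comp// [map_entropy W]map_entropyE.
rewrite -!opprD lerNl opprK -!big_split/= -subr_ge0 -sumrB.
apply: (@le_trans _ _ (\sum_w (law W w -
    law (joint X Z) (gx w) * law (joint Y Z) (gy w) / law Z w.2))).
  rewrite sumrB sum_law// subr_ge0.
  rewrite -(pair_bigA _ (fun (u : I * J) k =>
    law (joint X Z) (u.1, k) * law (joint Y Z) (u.2, k) / law Z k))/=.
  rewrite exchange_big/=.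
  rewrite -(sum_law (mcomp _ snd)); apply: ler_sum => k _.
  rewrite -(pair_bigA _ (fun i j =>
    law (joint X Z) (i, k) * law (joint Y Z) (j, k) / law Z k))/=.
  under eq_bigr => i _ do rewrite -mulr_suml -mulr_sumr.
  rewrite -mulr_suml -mulr_suml !sum_law_joint//; last 2 first.
  - exact: (mcomp _ gy).
  - exact: (mcomp _ gx).
  have [c0|c0] := eqVneq (law Z k) 0; first by rewrite c0 !mul0r.
  by rewrite mulfK.
apply: ler_sum => w _.
apply: le_trans (mutual_information_term _ _ _ _) _.
- exact: law_ge0.
- exact: (law_le_comp gx).
- exact: (law_le_comp gy).
- exact: (law_le_comp snd).
rewrite le_eqVlt; apply/orP; left; apply/eqP.
by rewrite -!mulrDr -mulrBr; congr (_ * _); lra.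
Qed.
End finite_entropy.

(** * Conditional entropy *)

Section conditional_entropy.
Context (d : measure_display) (T : measurableType d) (R : realType).
Variable mu : probability T R.
Local Notation H := (map_entropy mu).
Local Notation Hc := (cond_entropy mu).

Lemma block_eqP (J : finType) n (X : nat -> T -> J) x y :
  block n X x = block n X y <-> forall p, (p < n)%N -> X p x = X p y.
Proof.
split=> [/ffunP h p pn|h]; first by have := h (Ordinal pn); rewrite !ffunE.
by apply/ffunP => p; rewrite !ffunE h.
Qed.

Lemma map_entropy_le (I J : finType) (Z : T -> I) (Y : T -> J) :
  determines Z Y -> fibre_measurable Z -> H Y <= H Z.
Proof.
move=> /determines_factor[g ->] mZ; rewrite map_entropy_comp// map_entropyE lerN2.
apply: ler_sum => i _; have := law_ge0 mu Z i; rewrite le_eqVlt.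
move=> /predU1P[<-|p0]; first by rewrite !mul0r.
by rewrite ler_pM2l// ler_ln ?posrE// ?(lt_le_trans p0)// law_le_comp.
Qed.

Lemma map_entropy_eq (I J : finType) (Z : T -> I) (Y : T -> J) :
  fibre_measurable Z -> determines Z Y -> determines Y Z -> H Y = H Z.
Proof.
move=> mZ ZY YZ; apply/eqP; rewrite eq_le !map_entropy_le//.
exact: fibre_measurable_determines mZ.
Qed.

(** Knowing more decreases conditional entropy: submodularity for [X], [Z] and
    [Z'], in which [(Z, Z')] carries the same information as [Z]. *)
Lemma cond_entropy_anti (I J K : finType)
    (X : T -> I) (Z : T -> J) (Z' : T -> K) :
  fibre_measurable X -> fibre_measurable Z -> determines Z Z' ->
  Hc X Z <= Hc X Z'.
Proof.
move=> mX mZ ZZ'; have mZ' := fibre_measurable_determines ZZ' mZ.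
have mXZ := fibre_measurable_joint mX mZ.
have := map_entropy_submodular mu (fibre_measurable_joint mXZ mZ').
rewrite (@map_entropy_eq _ _ (joint X Z) (joint (joint X Z) Z'))//; last 2 first.
- by move=> x y [eX eZ]; congr (_, _, _) => //; exact: ZZ'.
- by move=> x y [eX eZ _]; congr (_, _).
rewrite (@map_entropy_eq _ _ Z (joint Z Z'))//; last 2 first.
- by move=> x y eZ; congr (_, _) => //; exact: ZZ'.
- by move=> x y [].
by rewrite /cond_entropy; lra.
Qed.

Lemma cond_entropy_joint (I J K : finType)
    (X : T -> I) (Y : T -> J) (Z : T -> K) :
  fibre_measurable X -> fibre_measurable Y -> fibre_measurable Z ->
  Hc (joint X Y) Z <= Hc X Z + Hc Y Z.
Proof.
move=> mX mY mZ; have := map_entropy_submodular mu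
  (fibre_measurable_joint (fibre_measurable_joint mX mY) mZ).
by rewrite /cond_entropy; lra.
Qed.

Lemma cond_entropy_determines (I J K : finType)
    (X : T -> I) (Y : T -> J) (Z : T -> K) :
  fibre_measurable X -> fibre_measurable Z -> determines (joint X Z) Y ->
  Hc Y Z <= Hc X Z.
Proof.
move=> mX mZ XZY; rewrite lerB// map_entropy_le//.
  by move=> x y e; congr (_, _); [exact: XZY|case: e].
exact: fibre_measurable_joint.
Qed.

Lemma cond_entropy_block (J K : finType) n (X : nat -> T -> J) (Z : T -> K) :
  (forall p, fibre_measurable (X p)) -> fibre_measurable Z ->
  Hc (block n X) Z <= \sum_(p < n) Hc (X p) Z.
Proof.
move=> mX mZ; elim: n => [|n IH].
  rewrite big_ord0 subr_le0 map_entropy_le//.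
  by move=> x y e; congr (_, _) => //; apply/ffunP; case.
rewrite big_ord_recr/=; apply: le_trans (lerD IH (lexx _)).
have mb := fibre_measurable_block (n := n) mX.
apply: le_trans (cond_entropy_joint mb (mX n) mZ).
apply: cond_entropy_determines => //; first exact: fibre_measurable_joint.
move=> x y [/block_eqP eX en _]; apply/block_eqP => p.
by rewrite ltnS leq_eqVlt => /predU1P[->|/eX].
Qed.

Lemma map_entropy_le_cond (I J : finType) (X : T -> I) (Z : T -> J) :
  fibre_measurable X -> fibre_measurable Z -> H X <= Hc X Z + H Z.
Proof.
move=> mX mZ; rewrite subrK map_entropy_le//; first by move=> x y [].
exact: fibre_measurable_joint.
Qed.

Lemma map_entropy_unit (X : T -> unit) : H X = 0.
Proof.
rewrite map_entropyE (big_pred1 tt)/=; last by case.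
rewrite /law (_ : _ @^-1` _ = setT) ?probability_setT/= ?ln1 ?mulr0 ?oppr0//.
by apply/seteqP; split => // x _ /=; case: (X x).
Qed.

Lemma cond_entropy_le (I J : finType) (X : T -> I) (Z : T -> J) :
  fibre_measurable X -> fibre_measurable Z -> Hc X Z <= H X.
Proof.
move=> mX mZ; apply: (@le_trans _ _ (Hc X (fun=> tt))).
  exact: cond_entropy_anti.
rewrite /cond_entropy map_entropy_unit subr0 map_entropy_le//.
by move=> x y eX; congr (_, _).
Qed.

End conditional_entropy.

(** * Entropy rate of a stationary process *)

Definition itinerary (T : Type) (f : T -> T) (J : finType) (n : nat) (X : T -> J) :=
  block n (fun p => X \o iter p f).

Section stationary.
Context (d : measure_display) (T : measurableType d) (R : realType).
Variables (mu : probability T R) (f : T -> T).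
Hypothesis f_measurable : forall A, measurable A -> measurable (f @^-1` A).
Hypothesis f_invariant : invariant_measure f mu.
Local Notation H := (map_entropy mu).
Local Notation Hc := (cond_entropy mu).
Local Notation itinerary := (itinerary f).

Lemma measurable_iter p A : measurable A -> measurable (iter p f @^-1` A).
Proof. by elim: p A => // p IH A mA; exact: (IH _ (f_measurable mA)). Qed.

Lemma fibre_measurable_iter (I : Type) (X : T -> I) p :
  fibre_measurable X -> fibre_measurable (X \o iter p f).
Proof. by move=> mX i; exact: measurable_iter (mX i). Qed.

Lemma fibre_measurable_cst (I : Type) (c : I) : fibre_measurable (fun _ : T => c).
Proof. by move=> i; rewrite preimage_cst; case: ifP. Qed.

Lemma fibre_measurable_itinerary (J : finType) n (X : T -> J) :
  fibre_measurable X -> fibre_measurable (itinerary n X).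
Proof.
by move=> mX; apply: fibre_measurable_block => p; exact: fibre_measurable_iter.
Qed.

Lemma map_entropy_iter (I : finType) (X : T -> I) p :
  fibre_measurable X -> H (X \o iter p f) = H X.
Proof.
move=> mX; elim: p => // p <-; rewrite !map_entropyE.
congr (- _); apply: eq_bigr => i _.
suff -> : law mu (X \o iter p.+1 f) i = law mu (X \o iter p f) i by [].
rewrite /law -[in RHS]f_invariant//; last exact: fibre_measurable_iter.
by congr (fine (mu _)); apply/seteqP; split => x /=; rewrite -iterSr.
Qed.

Lemma itineraryP (J : finType) n (X : T -> J) x y :
  itinerary n X x = itinerary n X y <->
  forall p, (p < n)%N -> X (iter p f x) = X (iter p f y).
Proof. exact: block_eqP. Qed.

Lemma determines_itinerary (I J : finType) n (X : T -> I) (Y : T -> J) :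
  determines X Y -> determines (itinerary n X) (itinerary n Y).
Proof.
by move=> XY x y /itineraryP h; apply/itineraryP => p pn; exact/XY/h.
Qed.

(** Submodularity with [X] the symbol at time [0], [Y] the symbol at time
    [n + 1] and [Z] the symbols in between; by invariance the times [1] to
    [n + 1] have the entropy of the times [0] to [n]. *)
Lemma map_entropy_itinerary_concave (J : finType) (X : T -> J) n :
  fibre_measurable X ->
  H (itinerary n.+2 X) + H (itinerary n X) <=
  H (itinerary n.+1 X) + H (itinerary n.+1 X).
Proof.
move=> mX; have mI p m := fibre_measurable_iter m
  (fibre_measurable_itinerary (n := p) mX).
have mX' m := fibre_measurable_iter m mX.
have := map_entropy_submodular mu (fibre_measurable_joint
  (fibre_measurable_joint mX (mX' n.+1)) (mI n 1)).
(* Each of the four maps carries the information of an itinerary, up to a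
   shift. *)
rewrite (map_entropy_iter 1)//; last exact: mI _ 0.
rewrite (@map_entropy_eq _ _ _ mu _ _ (itinerary n.+2 X)
  (joint (joint X (X \o iter n.+1 f)) (itinerary n X \o iter 1 f))); last 3 first.
- exact: mI _ 0.
- move=> x y /itineraryP h; congr (_, _, _); [exact: (h 0)|exact: (h n.+1)|].
  by apply/itineraryP => p pn; have := h p.+1 (leqW pn); rewrite !iterSr.
- move=> x y [h0 hn /itineraryP h]; apply/itineraryP => -[//|p].
  rewrite ltnS leq_eqVlt => /predU1P[[->]//|pn].
  by rewrite !iterSr; exact: h.
rewrite (@map_entropy_eq _ _ _ mu _ _ (itinerary n.+1 X)
  (joint X (itinerary n X \o iter 1 f))); last 3 first.
- exact: mI _ 0.
- move=> x y /itineraryP h; congr (_, _); first exact: (h 0).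
  by apply/itineraryP => p pn; have := h p.+1 pn; rewrite !iterSr.
- move=> x y [h0 /itineraryP h]; apply/itineraryP => -[//|p pn].
  by rewrite !iterSr; exact: h.
rewrite (@map_entropy_eq _ _ _ mu _ _ (itinerary n.+1 X \o iter 1 f)
  (joint (X \o iter n.+1 f) (itinerary n X \o iter 1 f))).
- by rewrite map_entropy_iter//; exact: mI _ 0.
- exact: mI.
- move=> x y /itineraryP h; congr (_, _).
    by have := h n (leqnn _); rewrite /= -!iterSr.
  by apply/itineraryP => p pn; apply: h; exact: ltnW.
- move=> x y [hn /itineraryP h]; apply/itineraryP => p.
  rewrite ltnS leq_eqVlt => /predU1P[->|]; last exact: h.
  by rewrite /= -!iterSr.
Qed.

Lemma map_entropy_itinerary0 (J : finType) (X : T -> J) : H (itinerary 0 X) = 0.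
Proof.
rewrite -(map_entropy_unit mu (fun=> tt)); apply: map_entropy_eq => //.
  exact: fibre_measurable_cst.
by move=> x y _; apply/itineraryP.
Qed.

(** By concavity the increments of the entropies form a nonincreasing
    nonnegative sequence, which converges; the quotients are its Cesaro
    means. *)
Lemma entropy_rate_is_cvg (J : finType) (X : T -> J) : fibre_measurable X ->
  cvgn (fun n => n%:R^-1 * H (itinerary n X)).
Proof.
move=> mX; have mI n := fibre_measurable_itinerary (n := n) mX.
pose D := telescope (fun n => H (itinerary n X)).
have : cvgn D.
  apply: nonincreasing_is_cvgn.
    apply/nonincreasing_seqP => n.
    rewrite lerBlDr addrAC -[leRHS]/(_ + _) lerBrDr.
    exact: map_entropy_itinerary_concave.
  exists 0 => _ [n _ <-]; rewrite subr_ge0; apply: map_entropy_le; last exact: mI.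
  by move=> x y /itineraryP h; apply/itineraryP => p pn; exact/h/ltnW.
move=> /cesaro DL; apply: cvgP; rewrite -cvg_shiftS.
apply: cvg_trans DL; apply: near_eq_cvg; apply: nearW => n.
by rewrite /arithmetic_mean/= /D telescopeK/= map_entropy_itinerary0 subr0.
Qed.

Definition rate (J : finType) (X : T -> J) : R :=
  limn (fun n => n%:R^-1 * H (itinerary n X)).

Lemma entropy_itinerary (J : finType) (X : T -> J) n :
  entropy mu (@iter_join T J n (fun p i => iter p f @^-1` (X @^-1` [set i]))) =
  H (itinerary n X).
Proof.
congr (- _); apply: eq_bigr => g _.
suff -> : iter_join (fun p i => iter p f @^-1` (X @^-1` [set i])) g =
  itinerary n X @^-1` [set g] by [].
apply/seteqP; split => x; rewrite /iter_join /=.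
  by move=> h; apply/ffunP => p; rewrite ffunE; exact: h.
by move=> <- p _ /=; rewrite ffunE.
Qed.

Lemma entropy_rateE (J : finType) (X : T -> J) : fibre_measurable X ->
  entropy_rate mu (fun p i => iter p f @^-1` (X @^-1` [set i])) = (rate X)%:E.
Proof.
move=> mX; rewrite /rate -EFin_lim; last exact: entropy_rate_is_cvg.
by congr (limn _); apply/funext => n /=; rewrite entropy_itinerary.
Qed.

Lemma rate_le_determines (I J : finType) (X : T -> I) (Y : T -> J) :
  fibre_measurable X -> determines X Y -> rate Y <= rate X.
Proof.
move=> mX XY; have mY := fibre_measurable_determines XY mX.
apply: ler_lim; [exact: entropy_rate_is_cvg|exact: entropy_rate_is_cvg|].
apply: nearW => n; rewrite ler_wpM2l// map_entropy_le//.
  exact: determines_itinerary.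
exact: fibre_measurable_itinerary.
Qed.

Lemma cond_entropy_iter (I J : finType) (X : T -> I) (Z : T -> J) p :
  fibre_measurable X -> fibre_measurable Z ->
  Hc (X \o iter p f) (Z \o iter p f) = Hc X Z.
Proof.
move=> mX mZ; have := map_entropy_iter p (fibre_measurable_joint mX mZ).
by rewrite /cond_entropy (map_entropy_iter p mZ) => <-.
Qed.

Lemma map_entropy_itineraryD (J : finType) (X : T -> J) m n : fibre_measurable X ->
  H (itinerary (m + n) X) <= H (itinerary m X) + H (itinerary n X).
Proof.
move=> mX; have mI n' := fibre_measurable_itinerary (n := n') mX.
have mJ := fibre_measurable_iter m (mI n).
apply: (@le_trans _ _ (H (joint (itinerary n X \o iter m f) (itinerary m X)))).
  apply: map_entropy_le; last exact: (fibre_measurable_joint mJ (mI m)).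
  move=> x y [/itineraryP hn /itineraryP hm]; apply/itineraryP => p pmn.
  have [pm|mp] := ltnP p m; first exact: hm.
  by rewrite -(subnK mp) !iterD; apply: hn; rewrite ltn_subLR.
have := cond_entropy_le mu mJ (mI m).
by rewrite (map_entropy_iter m (mI n)) /cond_entropy; lra.
Qed.

(** Given the itinerary of [Z], each of the [m] symbols of [X] costs at most
    its conditional entropy given the simultaneous symbol of [Z]. *)
Lemma map_entropy_itinerary_le (I J : finType) (X : T -> I) (Z : T -> J) m :
  fibre_measurable X -> fibre_measurable Z ->
  H (itinerary m X) <= H (itinerary m Z) + m%:R * Hc X Z.
Proof.
move=> mX mZ; have mI := fibre_measurable_itinerary.
apply: le_trans (map_entropy_le_cond mu (mI _ m _ mX) (mI _ m _ mZ)) _.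
rewrite addrC lerD2l.
apply: le_trans (cond_entropy_block _ _ _ _) _; [|exact: mI|].
  by move=> p; exact: fibre_measurable_iter.
rewrite mulr_natl -[X in _ *+ X]card_ord -sumr_const; apply: ler_sum => p _.
rewrite -(cond_entropy_iter p mX mZ); apply: cond_entropy_anti.
- exact: fibre_measurable_iter.
- exact: mI.
- by move=> x y /itineraryP; exact.
Qed.

(** The [m]-step itinerary of the [n]-step itineraries of [P] is a function of
    the first [m + n] symbols of [P]. The [n] additional symbols have bounded
    entropy, which disappears after division by [m]. *)
Lemma rate_le (I J : finType) (X : T -> I) (P : T -> J) n :
  fibre_measurable X -> fibre_measurable P ->
  rate X <= rate P + Hc X (itinerary n P).
Proof.
move=> mX mP; have mI k := fibre_measurable_itinerary (n := k) mP.
set c := Hc _ _.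
have inv0 : (fun m => m%:R^-1 : R) @ \oo --> (0 : R).
  by rewrite -cvg_shiftS; exact: cvg_harmonic.
have cv : (fun m => m%:R^-1 * H (itinerary m P) +
    (m%:R^-1 * H (itinerary n P) + c)) @ \oo -->
    rate P + (0 * H (itinerary n P) + c).
  apply: cvgD; first exact: entropy_rate_is_cvg.
  by apply: cvgD; [exact: cvgM inv0 (cvg_cst _)|exact: cvg_cst].
rewrite -[c]add0r -(mul0r (H (itinerary n P))) -(cvg_lim _ cv)//.
apply: ler_lim; [exact: entropy_rate_is_cvg|by apply/cvg_ex; eexists; exact: cv|].
near=> m.
have m0 : (0 : R) < m%:R by rewrite ltr0n; near: m; exact: nbhs_infty_gt.
rewrite -(ler_pM2l m0) mulrDr [X in _ + X]mulrDr !mulVKf ?lt0r_neq0//.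
apply: le_trans (map_entropy_itinerary_le m mX (mI n)) _.
rewrite -/c addrA lerD2r.
apply: le_trans (map_entropy_itineraryD m n mP).
apply: map_entropy_le => //; last exact: mI.
move=> x y /itineraryP h; apply/itineraryP => p pm; apply/itineraryP => q qn.
by rewrite -!iterD; apply: h; rewrite addnC -addnS leq_add// ltnW.
Unshelve. all: by end_near.
Qed.

End stationary.

(** * Approximation by an algebra of sets *)

Definition indic_of (T : Type) (A : set T) (x : T) : bool := `[< A x >].

Lemma indic_of_true (T : Type) (A : set T) : indic_of A @^-1` [set true] = A.
Proof. by apply/seteqP; split => x /=; [move/asboolP|move=> /asboolP]. Qed.

Lemma indic_of_eq (T : Type) (A : set T) x y :
  indic_of A x = indic_of A y <-> (A x <-> A y).
Proof.
split=> [e|e]; last by rewrite /indic_of; congr (`[< _ >]); exact/propext.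
by split=> /asboolP; rewrite -/(indic_of A _) (e, esym e) => /asboolP.
Qed.

Section approximation.
Context (d : measure_display) (T : measurableType d) (R : realType).
Variable mu : probability T R.

Lemma fibre_measurable_indic_of (A : set T) :
  measurable A -> fibre_measurable (indic_of A).
Proof.
move=> mA [|]; first by rewrite indic_of_true.
rewrite (_ : _ @^-1` _ = ~` A); first exact: measurableC.
by apply/seteqP; split => x /=; [move/asboolP|move=> /asboolPn/negbTE].
Qed.

(** Again [ln t <= t - 1], applied to the inverse of the square root of
    [x]: an explicit form of the continuity of [x ln x] at [0]. *)
Lemma xlnx_le_sqrt (x : R) : 0 <= x -> - (x * ln x) <= 2 * Num.sqrt x.
Proof.
rewrite le_eqVlt => /predU1P[<-|x0]; first by rewrite mul0r oppr0 sqrtr0 mulr0.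
have s0 : 0 < Num.sqrt x by rewrite sqrtr_gt0.
have xE : x = Num.sqrt x * Num.sqrt x by rewrite -expr2 sqr_sqrtr// ltW.
have : ln (Num.sqrt x)^-1 <= (Num.sqrt x)^-1 - 1.
  rewrite -{1}[_^-1](subrKC 1); apply: le_ln1Dx.
  by rewrite ltrBrDl subrr invr_gt0.
rewrite lnV ?posrE// => h.
rewrite [in ln x]xE lnM ?posrE// {1}xE.
set s := Num.sqrt x in s0 h *; set l := ln s in h *.
have h2 : s * (s * - l) <= s * (s * (s^-1 - 1)) by rewrite !ler_pM2l.
have e2 : s * (s * (s^-1 - 1)) = s - s * s by field; rewrite gt_eqF.
by nra.
Qed.

(** A set of probability [p <= e^2] contributes at most [2 sqrt p], and its
    complement, of probability [q = 1 - p], contributes [- q ln q <= p]. *)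
Lemma map_entropy_indic_of_le (A : set T) (e : R) : measurable A -> 0 <= e ->
  (mu A <= (e ^+ 2)%:E)%E -> map_entropy mu (indic_of A) <= 3 * e.
Proof.
move=> mA e0 muA; have mI := fibre_measurable_indic_of mA.
have p0 := law_ge0 mu (indic_of A) true; have q0 := law_ge0 mu (indic_of A) false.
have := sum_law mu mI; rewrite map_entropyE /index_enum !big_bool/=.
set p := law _ _ true in p0 *; set q := law _ _ false in q0 * => pq1.
have pe : p <= e ^+ 2.
  by rewrite -lee_fin /p /law indic_of_true fineK// fin_num_measure.
have se : Num.sqrt p <= e.
  by rewrite -[leRHS](ger0_norm e0) -sqrtr_sqr ler_sqrt// sqr_ge0.
have pl := xlnx_le_sqrt p0.
have ql : - (q * ln q) <= p.
  have [->|qn0] := eqVneq q 0; first by rewrite mul0r oppr0.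
  have {}q0 : 0 < q by rewrite lt_def qn0.
  have : ln q^-1 <= q^-1 - 1.
    rewrite -{1}[q^-1](subrKC 1); apply: le_ln1Dx.
    by rewrite ltrBrDl subrr invr_gt0.
  rewrite lnV ?posrE// -(ler_pM2l q0) mulrBr mulfV// mulr1 mulrN; lra.
have pp : p <= Num.sqrt p.
  have sp0 := sqrtr_ge0 p; have := sqr_sqrtr p0.
  have : Num.sqrt p <= 1 by rewrite -sqrtr1 ler_sqrt//; lra.
  by rewrite expr2; nra.
lra.
Qed.

Lemma measurable_setY (A B : set T) :
  measurable A -> measurable B -> measurable (A `+` B).
Proof. by move=> mA mB; apply: measurableU; exact: measurableD. Qed.

(** Once it is known whether a point is in [C], the remaining uncertainty about
    [A] is whether the point is in the symmetric difference. *)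
Lemma cond_entropy_indic_of_le (A C : set T) (e : R) :
  measurable A -> measurable C -> 0 <= e ->
  (mu (A `+` C) <= (e ^+ 2)%:E)%E ->
  cond_entropy mu (indic_of A) (indic_of C) <= 3 * e.
Proof.
move=> mA mC e0 muAC; have mD := measurable_setY mA mC.
have mIA := fibre_measurable_indic_of mA.
have mIC := fibre_measurable_indic_of mC.
have mID := fibre_measurable_indic_of mD.
apply: le_trans (map_entropy_indic_of_le mD e0 muAC).
apply: le_trans (cond_entropy_le mu mID mIC).
apply: cond_entropy_determines => // x y [/indic_of_eq eD /indic_of_eq eC].
apply/indic_of_eq; move: eD eC; rewrite /setY/=.
by have [] := pselect (A x); have [] := pselect (A y);
  have [] := pselect (C x); have [] := pselect (C y); tauto.
Qed.

(** The map [X] is determined by the indicators of its [s] fibres. *)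
Lemma cond_entropy_le_approx s (J : finType) (X : T -> 'I_s) (Z : T -> J)
    (C : 'I_s -> set T) (e : R) :
  fibre_measurable X -> fibre_measurable Z -> 0 <= e ->
  (forall i, determines Z (indic_of (C i))) ->
  (forall i, (mu ((X @^-1` [set i]) `+` C i) <= (e ^+ 2)%:E)%E) ->
  cond_entropy mu X Z <= s%:R * (3 * e).
Proof.
move=> mX mZ e0 ZC XC.
pose Y p := indic_of [set x | X x = p :> nat].
have YE (i : 'I_s) : Y i = indic_of (X @^-1` [set i]).
  congr indic_of; apply/seteqP; split => x /=; first by move=> ?; exact/val_inj.
  by move=> ->.
have mY p : fibre_measurable (Y p).
  have [ps|sp] := ltnP p s.
    by rewrite (YE (Ordinal ps)); exact: fibre_measurable_indic_of.
  apply: fibre_measurable_indic_of; rewrite (_ : [set _ | _] = set0)//.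
  by apply/seteqP; split => // x /= Xp; have := ltn_ord (X x); rewrite Xp ltnNge sp.
apply: (@le_trans _ _ (cond_entropy mu (block s Y) Z)).
  apply: cond_entropy_determines => //; first exact: fibre_measurable_block.
  move=> x y [/block_eqP e' _]; have := e' (X x) (ltn_ord _).
  by move=> /indic_of_eq [/= /(_ erefl) /val_inj <-].
apply: le_trans (cond_entropy_block _ _ _ _) _ => //.
rewrite mulr_natl -[X in _ *+ X]card_ord -sumr_const; apply: ler_sum => i _.
have mC : measurable (C i).
  by rewrite -[C i]indic_of_true; exact: fibre_measurable_determines (ZC i) mZ _.
apply: le_trans (cond_entropy_anti mu _ mZ (ZC i)) _; first exact: mY.
by rewrite YE; exact: cond_entropy_indic_of_le.
Qed.

Definition approximable (D : set (set T)) : set (set T) :=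
  [set A | measurable A /\
    forall e : R, 0 < e -> exists2 C, D C & (mu (A `+` C) <= e%:E)%E].

Lemma measure_setY_bigcup_le (A C : (set T)^nat) n :
  (forall k, measurable (A k)) -> (forall k, measurable (C k)) ->
  (mu ((\bigcup_k A k) `+` \big[setU/set0]_(k < n) C k) <=
   mu (\bigcup_k A k `\` \big[setU/set0]_(k < n) A k) +
   \sum_(k < n) mu (A k `+` C k))%E.
Proof.
move=> mA mC.
have mAC k : measurable (A k `+` C k) by exact: measurable_setY.
have mS (F : (set T)^nat) m : (forall k, measurable (F k)) ->
    measurable (\big[setU/set0]_(k < m) F k).
  by move=> mF; exact: bigsetU_measurable.
have mA' := bigcupT_measurable _ mA.
apply: (@le_trans _ _ (mu ((\bigcup_k A k `\` \big[setU/set0]_(k < n) A k) `|`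
    \big[setU/set0]_(k < n) (A k `+` C k)))).
  apply: le_measure; rewrite ?inE.
  - by apply: measurable_setY => //; exact: mS.
  - apply: measurableU; last exact: (mS _ n mAC).
    by apply: measurableD => //; exact: mS.
  rewrite -(bigcup_mkord n A) -(bigcup_mkord n C).
  rewrite -(bigcup_mkord n (fun k => A k `+` C k)).
  move=> x [[[k _ Akx] nC]|[[k kn Ckx] nA]].
    have [[l ln Alx]|nl] := pselect ((\bigcup_(i < n) A i) x).
      by right; exists l => //; left; split => // ?; apply: nC; exists l.
    by left; split => //; exists k.
  right; exists k => //; right; split => // Akx.
  by apply: nA; exists k.
have mD : measurable (\bigcup_k A k `\` \big[setU/set0]_(k < n) A k).
  by apply: measurableD => //; exact: mS.
apply: le_trans (measureU2 mu mD (mS _ n mAC)) _.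
rewrite leeD2l//; elim: n {mD} => [|n IH]; first by rewrite !big_ord0 measure0.
rewrite !big_ord_recr/=; apply: le_trans (measureU2 mu (mS _ n mAC) (mAC n)) _.
by rewrite leeD2r.
Qed.

(** A countable union is first replaced by a finite one, losing little measure
    by continuity, and the members of the finite union are then approximated
    one by one. *)
Lemma sigma_algebra_approximable (D : set (set T)) :
  D `<=` measurable -> D set0 -> (forall A, D A -> D (~` A)) ->
  (forall A B, D A -> D B -> D (A `|` B)) ->
  sigma_algebra setT (approximable D).
Proof.
move=> Dm D0 DC DU; split.
- split=> // e e0; exists set0 => //.
  by rewrite setYK measure0 lee_fin ltW.
- move=> A [mA apA]; rewrite setTD; split; first exact: measurableC.
  move=> e /apA[C DC' le]; exists (~` C); first exact: DC.
  rewrite (_ : _ `+` _ = A `+` C)//; apply/seteqP; rewrite /setY; split=> x /=;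
  by have [] := pselect (A x); have [] := pselect (C x); tauto.
move=> A apA; have mA k : measurable (A k) by case: (apA k).
split; first exact: bigcupT_measurable.
move=> e e0.
pose B n := \bigcup_k A k `\` \big[setU/set0]_(k < n) A k.
have mB n : measurable (B n).
  by apply: measurableD; [exact: bigcupT_measurable|exact: bigsetU_measurable].
have B0 : \bigcap_n B n = set0.
  apply/seteqP; split => // x BT; have [[k _ Akx] _] := BT 0 I.
  have [_ ] := BT k.+1 I; apply; rewrite -bigcup_mkord.
  by exists k => //=.
have : mu \o B @ \oo --> mu (\bigcap_n B n).
  apply: nonincreasing_cvg_mu => //.
  - by rewrite ltey_eq fin_num_measure.
  - by rewrite B0.
  move=> m n mn; apply/subsetPset; apply: setDS.
  exact: subset_bigsetU.
rewrite B0 measure0 => /fine_cvgP[_ /cvgrPdist_le/(_ (e / 2))].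
rewrite divr_gt0// => /(_ isT) [n _ /(_ n (leqnn n))/=].
rewrite sub0r normrN ger0_norm ?fine_ge0// => Bn.
have d0 : 0 < e / 2 / n.+1%:R by rewrite !divr_gt0.
have /choice[C CP] k : exists C, D C /\
    (mu (A k `+` C) <= (e / 2 / n.+1%:R)%:E)%E.
  by have [_ /(_ _ d0)[C]] := apA k; exists C.
have mC k : measurable (C k) by apply: Dm; case: (CP k).
exists (\big[setU/set0]_(k < n) C k).
  by elim/big_rec: _ => // i E _ DE; apply: DU => //; case: (CP i).
apply: le_trans (measure_setY_bigcup_le n mA mC) _.
rewrite (_ : e = e / 2 + e / 2); last by rewrite -splitr.
rewrite EFinD; apply: leeD.
  by rewrite -(fineK (fin_num_measure mu _ (mB n))) lee_fin.
apply: (@le_trans _ _ (\sum_(k < n) (e / 2 / n.+1%:R)%:E)%E).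
  by apply: lee_sum => k _; case: (CP k).
rewrite sumEFin lee_fin sumr_const card_ord -[leLHS]mulr_natr.
by rewrite mulrAC ler_pdivrMr// ler_pM2l ?divr_gt0// ler_nat.
Qed.
End approximation.

(** * Generator theorem *)

Definition membership (T : Type) (Bs : seq (set T)) (x : T) :
    {ffun 'I_(size Bs) -> bool} :=
  [ffun i : 'I_(size Bs) => indic_of (nth set0 Bs i) x].

Lemma membership_eqP (T : Type) (Bs : seq (set T)) x y :
  membership Bs x = membership Bs y <-> forall B, B \in Bs -> (B x <-> B y).
Proof.
split=> [/ffunP e B BBs|e].
  have iBs : (index B Bs < size Bs)%N by rewrite index_mem.
  by have := e (Ordinal iBs); rewrite !ffunE/= nth_index// => /indic_of_eq.
by apply/ffunP => i; rewrite !ffunE; apply/indic_of_eq/e/mem_nth.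
Qed.

Section generator.
Context (d : measure_display) (T : measurableType d) (R : realType).
Variables (mu : probability T R) (f : T -> T).
Hypothesis f_measurable : forall A, measurable A -> measurable (f @^-1` A).
Hypothesis f_invariant : invariant_measure f mu.
Variable G : set (set T).
Hypothesis G_measurable : G `<=` measurable.

Lemma fibre_measurable_membership (Bs : seq (set T)) :
  (forall B, B \in Bs -> G B) -> fibre_measurable (membership Bs).
Proof.
move=> GBs.
rewrite (_ : membership Bs =
  block (size Bs) (fun i => indic_of (nth set0 Bs i)))//.
apply: fibre_measurable_block => i; apply: fibre_measurable_indic_of.
have [iBs|?] := ltnP i (size Bs); first exact/G_measurable/GBs/mem_nth.
by rewrite nth_default.
Qed.

Lemma determines_itinerary_membership m n (Bs Bs' : seq (set T)) :
  (m <= n)%N -> {subset Bs' <= Bs} ->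
  determines (itinerary f n (membership Bs)) (itinerary f m (membership Bs')).
Proof.
move=> mn sB x y /itineraryP h; apply/itineraryP => p pm.
apply/membership_eqP => B /sB BBs.
by have /membership_eqP := h p (leq_trans pm mn); exact.
Qed.

(** The algebra generated by the preimages of members of [G] under iterates,
    encoded without unions of cells: being determined by finitely many visits
    passes to complements and unions at once. *)
Definition finitary : set (set T) := [set C | exists n Bs,
  (forall B, B \in Bs -> G B) /\
  determines (itinerary f n (membership Bs)) (indic_of C)].

Lemma finitary_measurable : finitary `<=` measurable.
Proof.
move=> C [n [Bs [GBs dC]]]; rewrite -[C]indic_of_true.
apply: fibre_measurable_determines dC _ _.
exact/fibre_measurable_itinerary/fibre_measurable_membership.
Qed.

Lemma finitary0 : finitary set0.
Proof. by exists 0, [::]; split => // x y _; apply/indic_of_eq. Qed.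

Lemma finitaryC A : finitary A -> finitary (~` A).
Proof.
move=> [n [Bs [GBs dA]]]; exists n, Bs; split => // x y /dA /indic_of_eq e.
by apply/indic_of_eq; split=> /= + /e.
Qed.

Lemma finitaryU A B : finitary A -> finitary B -> finitary (A `|` B).
Proof.
move=> [n [As [GAs dA]]] [m [Bs [GBs dB]]]; exists (maxn n m), (As ++ Bs); split.
  by move=> C; rewrite mem_cat => /orP[/GAs|/GBs].
move=> x y e.
have /dA/indic_of_eq eA :
    itinerary f n (membership As) x = itinerary f n (membership As) y.
  apply: determines_itinerary_membership e; first exact: leq_maxl.
  by move=> C; rewrite mem_cat => ->.
have /dB/indic_of_eq eB :
    itinerary f m (membership Bs) x = itinerary f m (membership Bs) y.
  apply: determines_itinerary_membership e; first exact: leq_maxr.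
  by move=> C; rewrite mem_cat orbC => ->.
by apply/indic_of_eq; split=> -[/eA|/eB]; by [left|right].
Qed.

Lemma finitary_iter p B : G B -> finitary (iter p f @^-1` B).
Proof.
move=> GB; exists p.+1, [:: B]; split; first by move=> C; rewrite inE => /eqP ->.
move=> x y /itineraryP/(_ p (ltnSn p))/membership_eqP/(_ B (mem_head _ _)) e.
exact/indic_of_eq.
Qed.

Hypothesis G_generates : forall A, measurable A ->
  <<s [set A | exists p B, G B /\ A = iter p f @^-1` B] >> A.

Lemma measurable_approximable A : measurable A -> approximable mu finitary A.
Proof.
move=> /G_generates; apply: smallest_sub.
  apply: sigma_algebra_approximable.
  - exact: finitary_measurable.
  - exact: finitary0.
  - exact: finitaryC.
  - exact: finitaryU.
move=> _ [p [B [GB ->]]]; have fB := finitary_iter p GB.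
split; first exact: finitary_measurable.
move=> e e0; exists (iter p f @^-1` B) => //.
by rewrite setYK measure0 lee_fin ltW.
Qed.

(** All the fibres of [X] are approximated at once: the sets approximating them
    are determined by a common number of steps and a common finite family. *)
Lemma rate_le_membership s (X : T -> 'I_s) (e : R) : fibre_measurable X -> 0 < e ->
  exists Bs, (forall B, B \in Bs -> G B) /\
    rate mu f X <= rate mu f (membership Bs) + e.
Proof.
move=> mX e0.
(* The bound [s (3 c)] of the conditional entropy then stays below [e]; the
   successor avoids a division by zero. *)
pose c := e / (3 * s.+1%:R).
have c0 : 0 < c by rewrite divr_gt0// mulr_gt0.
have c2 : 0 < c ^+ 2 by rewrite exprn_gt0.
have /choice[C CP] : forall i : 'I_s, exists C, finitary C /\
    (mu ((X @^-1` [set i]) `+` C) <= (c ^+ 2)%:E)%E.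
  by move=> i; have [_ /(_ _ c2)[C]] := measurable_approximable (mX i); exists C.
have /choice[n /choice[Bs BsP]] := fun i => (CP i).1.
pose N := \max_i n i; pose Us := flatten [seq Bs i | i <- enum 'I_s].
have GUs B : B \in Us -> G B.
  by move=> /flattenP[_ /mapP[i _ ->]]; case: (BsP i) => h _; exact: h.
exists Us; split=> //; have mU := fibre_measurable_membership GUs.
apply: le_trans (rate_le f_measurable f_invariant N mX mU) _.
rewrite lerD2l.
have mI := fibre_measurable_itinerary f_measurable (n := N) mU.
apply: le_trans (cond_entropy_le_approx mX mI (ltW c0) _ (fun i => (CP i).2)) _.
  move=> i x y h; apply: (BsP i).2; apply: determines_itinerary_membership h.
    exact: (leq_bigmax i).
  move=> B BBs; apply/flattenP; exists (Bs i) => //.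
  by apply: map_f; rewrite mem_enum.
have -> : s%:R * (3 * c) = e * (s%:R / s.+1%:R).
  by rewrite /c; field; rewrite -[1]/(1%:R) -natrD pnatr_eq0.
apply: ler_piMr; first exact: ltW.
by rewrite ler_pdivrMr// mul1r ler_nat.
Qed.

End generator.

(** * Metric and Borel structure of the sphere *)

Section sphere.
Variable R : realType.
Implicit Types z w : R[i].
Local Notation normc := (@Normc.normc R).
Local Open Scope complex_scope.

Lemma normcE z : `|z| = (normc z)%:C.
Proof. by case: z. Qed.

Lemma normc_ge0 z : 0 <= normc z.
Proof. by case: z => a b; exact: sqrtr_ge0. Qed.

Lemma le_normc_add z w : normc (z + w) <= normc z + normc w.
Proof. exact: le_normcD. Qed.

Lemma normc_opp z : normc (- z) = normc z.
Proof. exact: normcN. Qed.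

Lemma normc_sub_sym z w : normc (z - w) = normc (w - z).
Proof. by rewrite -normc_opp opprB. Qed.

Lemma normc_le_ReIm z : normc z <= `|complex.Re z| + `|complex.Im z|.
Proof.
case: z => a b /=; rewrite -[leRHS]ger0_norm ?addr_ge0//.
rewrite -sqrtr_sqr ler_sqrt ?sqr_ge0//.
rewrite sqrrD !real_normK ?num_real//.
have := normr_ge0 a; have := normr_ge0 b; nra.
Qed.

Let nrm z : R := Num.sqrt (1 + normc z ^+ 2).

Lemma nrm_sqr z : nrm z ^+ 2 = 1 + normc z ^+ 2.
Proof. by rewrite sqr_sqrtr// addr_ge0// sqr_ge0. Qed.

Lemma nrm_ge1 z : 1 <= nrm z.
Proof. by rewrite -[leLHS]sqrtr1 ler_sqrt ?lerDl ?sqr_ge0// addr_ge0// sqr_ge0. Qed.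

Lemma nrm_le z : nrm z <= 1 + normc z.
Proof.
have := nrm_sqr z; have := nrm_ge1 z; have := normc_ge0 z; rewrite !expr2; nra.
Qed.

Lemma half_chord_ge0 (x y : sphere R) : 0 <= half_chord x y.
Proof.
have n0 z : 0 <= nrm z := le_trans ler01 (nrm_ge1 z).
case: x y => [z|] [w|] //=; rewrite ?invr_ge0 ?n0//.
by rewrite divr_ge0 ?normc_ge0// mulr_ge0// n0.
Qed.

(** At finite points, [|z - w| <= |z| + |w|] reduces the claim to
    [(b + c)^2 <= (1 + b^2) (1 + c^2)] for [b = |w|] and [c = |z|], that is, to
    [0 <= (1 - b c)^2]. *)
Lemma half_chord_le1 (x y : sphere R) : half_chord x y <= 1.
Proof.
have n0 z : 0 < nrm z := lt_le_trans ltr01 (nrm_ge1 z).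
case: x y => [z|] [w|] //=; rewrite -/(nrm _) ?invf_le1 ?nrm_ge1//.
rewrite -/(nrm w) ler_pdivrMr ?mul1r; last exact: mulr_gt0.
have := le_normc_add z (- w); rewrite normc_opp.
have := nrm_sqr z; have := nrm_sqr w; have := n0 z; have := n0 w.
have := normc_ge0 z; have := normc_ge0 w; have := normc_ge0 (z - w).
set a := normc _; set b := normc _; set c := normc _.
set p := nrm z; set q := nrm w => a0 b0 c0 q0 p0 eq_ ep abc.
have pq0 : 0 <= p * q by rewrite mulr_ge0// ltW.
rewrite -(@ler_pXn2r _ 2)// ?nnegrE// exprMn ep eq_.
apply: (@le_trans _ _ ((b + c) ^+ 2)).
  by rewrite ler_pXn2r ?nnegrE ?addr_ge0//; lra.
have := sqr_ge0 (1 - b * c); nra.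
Qed.

Lemma half_sphere_dist_itv (x y : sphere R) :
  asin (half_chord x y) \in `[(- (pi / 2)), pi / 2]%R.
Proof.
have h : -1 <= half_chord x y <= 1.
  by rewrite half_chord_le1 andbT (le_trans _ (half_chord_ge0 x y))// lerN10.
by rewrite in_itv/= asin_geNpi2// asin_lepi2.
Qed.

Lemma sin_half_dist (x y : sphere R) :
  sin (asin (half_chord x y)) = half_chord x y.
Proof.
apply: asinK; rewrite in_itv/= half_chord_le1 andbT.
by rewrite (le_trans _ (half_chord_ge0 x y))// lerN10.
Qed.

Lemma sphere_dist_le_pi (x y : sphere R) : sphere_dist x y <= pi.
Proof.
have := half_sphere_dist_itv x y; rewrite in_itv/= => /andP[_].
by rewrite /sphere_dist ler_pdivlMr// mulrC.
Qed.

Lemma sphere_dist_xx (x : sphere R) : sphere_dist x x = 0.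
Proof.
rewrite /sphere_dist (_ : half_chord x x = 0).
  have -> : asin (0 : R) = 0; last by rewrite mulr0.
  have := @sinK R 0; rewrite sin0; apply.
  by rewrite in_itv/= oppr_le0 divr_ge0 ?pi_ge0.
case: x => [z|]//=; rewrite subrr (_ : normc 0 = 0) ?mul0r//.
exact: Normc.normc0.
Qed.

Lemma half_chord_lt (e : R) : 0 < e -> exists2 r : R, 0 < r &
  forall x y : sphere R, half_chord x y < r -> sphere_dist x y < e.
Proof.
move=> e0; pose t := Num.min (e / 2) (pi / 2).
have t0 : 0 < t by rewrite lt_min !divr_gt0// pi_gt0.
have tpi : t <= pi / 2 by rewrite ge_min lexx orbT.
have tI : t \in `[(- (pi / 2)), pi / 2]%R.
  by rewrite in_itv/= tpi andbT (le_trans _ (ltW t0))// oppr_le0 divr_ge0 ?pi_ge0.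
exists (sin t).
  rewrite sin_gt0_pi// t0/= (le_lt_trans tpi)// ltr_pdivrMr//.
  by rewrite mulr_natr mulr2n ltrDl pi_gt0.
move=> x y; rewrite -sin_half_dist ltr_sin// ?half_sphere_dist_itv// => xy.
rewrite /sphere_dist mulrC -ltr_pdivlMr//.
by apply: lt_le_trans xy _; rewrite ge_min lexx.
Qed.

Lemma sphere_dist_lt (r : R) : 0 < r -> exists2 e : R, 0 < e &
  forall x y : sphere R, sphere_dist x y < e -> half_chord x y < r.
Proof.
move=> r0; pose t := Num.min r 1.
have t0 : 0 < t by rewrite lt_min r0/=.
have t1 : -1 <= t <= 1.
  by rewrite ge_min lexx orbT andbT (le_trans _ (ltW t0))// lerN10.
have tI : asin t \in `[(- (pi / 2)), pi / 2]%R.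
  by rewrite in_itv/= asin_geNpi2// asin_lepi2.
have st : sin (asin t) = t by apply: asinK; rewrite in_itv/=.
exists (2 * asin t).
  rewrite mulr_gt0// -ltr_sin// ?st ?sin0//.
  by rewrite in_itv/= oppr_le0 divr_ge0 ?pi_ge0.
move=> x y; rewrite /sphere_dist ltr_pM2l// => xy.
apply: (@lt_le_trans _ _ t); last by rewrite ge_min lexx.
by rewrite -st -sin_half_dist ltr_sin// half_sphere_dist_itv.
Qed.

Lemma half_chord_le_normc z w : half_chord (Some z) (Some w) <= normc (z - w).
Proof.
have n0 u : 0 < nrm u := lt_le_trans ltr01 (nrm_ge1 u).
rewrite /= -/(nrm z) -/(nrm w) ler_pdivrMr; last exact: mulr_gt0.
rewrite ler_peMr ?normc_ge0//.
by rewrite -[leLHS]mulr1 ler_pM// nrm_ge1.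
Qed.

(** With [s = |z - w|], the half chord times [sqrt (1 + |z|^2)] is at least
    [s / (1 + |z| + s)], which increases with [s]; hence a small chord forces a
    small [s]. *)
Lemma sphere_ball_finite z (r : R) : 0 < r -> exists2 e : R, 0 < e &
  forall y : sphere R, sphere_dist (Some z) y < e ->
    exists2 w, y = Some w & normc (z - w) < r.
Proof.
move=> r0; have n0 u : 0 < nrm u := lt_le_trans ltr01 (nrm_ge1 u).
have z0 := normc_ge0 z.
(* The first entry of the minimum keeps the point at infinity out of the ball. *)
pose c := (nrm z)^-1 * Num.min 1 (r / (1 + normc z + r)).
have c0 : 0 < c.
  by rewrite mulr_gt0 ?invr_gt0// lt_min ltr01 divr_gt0//; lra.
have [e e0 he] := sphere_dist_lt c0; exists e => // y /he.
case: y => [w|] /=; rewrite -/(nrm z) /c; last first.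
  by rewrite ltr_pMr ?invr_gt0// lt_min ltxx.
move=> h; exists w => //; move: h; rewrite -/(nrm w) invfM mulrA mulrAC mulrC.
rewrite ltr_pM2l ?invr_gt0// lt_min => /andP[_].
rewrite ltr_pdivrMr// mulrAC ltr_pdivlMr; last by lra.
have := nrm_le w; have := n0 w; have := le_normc_add z (w - z).
rewrite subrKC (normc_sub_sym w z); have := normc_ge0 (z - w).
set a := normc z; set b := normc w; set s := normc (z - w); set q := nrm w.
move=> s0 bas q0 q1 h; rewrite ltNge; apply/negP => rs.
have : r * q <= r * (1 + a + s) by rewrite ler_pM2l//; lra.
move=> h2; have : s * (1 + a + r) < r * (1 + a + s) by lra.
rewrite -/a in z0; nra.
Qed.

Local Notation baseT := (option (rat * rat * nat)).

(** A countable family that plays the role of a base. The singleton of the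
    point at infinity takes the place of its neighbourhoods: it is not open, but it
    is a Borel set. *)
Definition base_set (k : baseT) : set (sphere R) :=
  if k is Some (q1, q2, n) then
    Some @` [set z | normc (ratr q1 +i* ratr q2 - z) < n.+1%:R^-1]
  else [set None].

Lemma open_normc_ball z (r : R) : open ([set w | normc (z - w) < r] : set R[i]^o).
Proof.
rewrite (_ : [set w | _] = ball (z : R[i]^o) (r%:C : R[i])); first exact: ball_open.
rewrite -ball_normE; apply/seteqP; split => w /=; rewrite normcE ltcR//.
Qed.

Lemma open_contains_normc_ball (V : set R[i]^o) z : open V -> V z ->
  exists2 r : R, 0 < r & forall w, normc (z - w) < r -> V w.
Proof.
move=> oV Vz; have : nbhs (z : R[i]^o) V by exact: open_nbhs_nbhs.
move=> /nbhs_ballP[[r r']]; rewrite /= ltcE/= => /andP[/eqP -> r0] rV.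
exists r => // w zw; apply: rV; rewrite -ball_normE /= normcE.
by rewrite -[_ +i* 0]/(r%:C) ltcR.
Qed.

Lemma measurable_open (U : set (sphere R)) : open U -> measurable U.
Proof. exact: sub_gen_smallest. Qed.

Lemma open_some (V : set R[i]^o) : open V -> @open (sphere R) (Some @` V).
Proof. exact: one_point_compactification_open_some. Qed.

Lemma measurable_base_set k : measurable (base_set k).
Proof.
case: k => [[[q1 q2] n]|].
  by apply: measurable_open; apply: open_some; apply: open_normc_ball.
rewrite (_ : base_set None = ~` (Some @` [set: R[i]^o])).
  exact: measurableC (measurable_open (open_some openT)).
apply/seteqP; split => [x -> [w _] //|]; case=> [z|//] h.
by exfalso; apply: h; exists z.
Qed.

Lemma base_set_small (x : sphere R) (e : R) : 0 < e ->
  exists k, base_set k x /\ forall y, base_set k y -> sphere_dist x y < e.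
Proof.
move=> e0; case: x => [[a b]|]; last first.
  by exists None; split => // y /= ->; rewrite sphere_dist_xx.
have [r r0 hr] := half_chord_lt e0.
have [n] := @ltr_add_invr R 0 (r / 2) (divr_gt0 r0 (ltr0n _ 2)).
rewrite add0r => nr; pose t : R := n.+1%:R^-1 / 2.
have t0 : 0 < t by rewrite divr_gt0 ?invr_gt0.
have approx (c : R) : exists q : rat, `|ratr q - c| < t.
  have ct : c < c + t by rewrite ltrDl.
  have [q] := rat_in_itvoo ct; rewrite in_itv/= => /andP[cq qt].
  by exists q; rewrite gtr0_norm ?subr_gt0// ltrBlDl.
have [[q1 hq1] [q2 hq2]] := (approx a, approx b).
exists (Some (q1, q2, n)).
have near_center : normc (ratr q1 +i* ratr q2 - a +i* b) < n.+1%:R^-1.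
  apply: le_lt_trans (normc_le_ReIm _) _ => /=.
  by rewrite (splitr n.+1%:R^-1) ltrD.
split; first by exists (a +i* b).
move=> _ [w /= hw <-]; apply: hr; apply: le_lt_trans (half_chord_le_normc _ _) _.
have := le_normc_add (a +i* b - ratr q1 +i* ratr q2) (ratr q1 +i* ratr q2 - w).
rewrite subrKA => /le_lt_trans; apply.
by rewrite (normc_sub_sym (a +i* b)) (splitr r) ltrD// (lt_trans _ nr).
Qed.
End sphere.

(** * Measurable structure of the path space *)

Section paths.
Variables (R : realType) (M : nat) (Gamma : correspondence R M).
Implicit Types x y : path_space Gamma.
Local Notation shift := (@path_shift R M Gamma).
Local Notation Pi := (@Pi R M Gamma).
Local Notation Proj := (@Proj R M Gamma).

Lemma Pi_iter_shift r p x : Pi r (iter p shift x) = Pi (r + p) x.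
Proof. by elim: p r => [|p IH] r; rewrite ?addn0// addnS -addSn -IH. Qed.

Lemma Proj_iter_shift r p x : Proj r.+1 (iter p shift x) = Proj (r + p).+1 x.
Proof. by elim: p r => [|p IH] r; rewrite ?addn0// addnS -addSn -IH. Qed.

Lemma half_exp_le1 r : 2 ^- r <= 1 :> R.
Proof. by rewrite invf_le1 ?exprn_gt0// exprn_ege1// ler1n. Qed.

Lemma half_exp_decr m n : (m <= n)%N -> 2 ^- n <= 2 ^- m :> R.
Proof. by move=> mn; rewrite lef_pV2 ?posrE ?exprn_gt0// ler_weXn2l// ler1n. Qed.

Lemma half_exp_gt0 r : 0 < 2 ^- r :> R.
Proof. by rewrite invr_gt0 exprn_gt0. Qed.

Lemma path_dist_ge_point x y r :
  2 ^- r * sphere_dist (Pi r x) (Pi r y) <= path_dist x y.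
Proof.
rewrite /path_dist le_max; apply/orP; left.
apply: ub_le_sup; last by exists r.
exists pi => _ [k _ <-].
apply: (@le_trans _ _ (2 ^- k * pi)).
  by rewrite ler_pM2l ?half_exp_gt0// sphere_dist_le_pi.
by rewrite ler_piMl ?pi_ge0// half_exp_le1.
Qed.

Lemma path_dist_ge_label x y r :
  Proj r.+1 x != Proj r.+1 y -> 2 ^- r.+1 <= path_dist x y.
Proof.
move=> xy; rewrite /path_dist le_max; apply/orP; right.
rewrite -[leLHS]mulr1 -[X in _ * X]/((true : nat)%:R) -xy.
apply: ub_le_sup; last by exists r.+1.
exists 1 => _ [k _ <-]; apply: le_trans (half_exp_le1 k).
by apply: ler_piMr; [exact: ltW (half_exp_gt0 k)|case: (_ != _)].
Qed.

(** Coordinates from [n] on contribute at most [2^-n pi], for the spherical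
    distance is bounded by [pi], and so is the discrete distance on labels. *)
Lemma path_dist_le x y (e : R) n :
  (forall r, (r < n)%N -> sphere_dist (Pi r x) (Pi r y) <= e) ->
  (forall r, (r < n)%N -> Proj r.+1 x = Proj r.+1 y) ->
  2 ^- n * pi <= e -> path_dist x y <= e.
Proof.
move=> hP hL hn.
have e0 : 0 <= e.
  by apply: le_trans hn; rewrite mulr_ge0 ?pi_ge0// ltW// half_exp_gt0.
rewrite /path_dist ge_max; apply/andP; split; apply: ge_sup.
- by eexists; exists 0%N.
- move=> _ [r _ <-]; have [rn|nr] := ltnP r n.
    apply: (@le_trans _ _ (2 ^- r * e)).
      by rewrite ler_pM2l ?half_exp_gt0//; exact: hP.
    by rewrite ler_piMl// half_exp_le1.
  apply: le_trans hn; apply: (@le_trans _ _ (2 ^- r * pi)).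
    by rewrite ler_pM2l ?half_exp_gt0// sphere_dist_le_pi.
  by rewrite ler_pM2r ?pi_gt0// half_exp_decr.
- by eexists; exists 1%N.
move=> _ [[//|r] _ <-]; have [rn|nr] := ltnP r n; first by rewrite hL// eqxx mulr0.
apply: le_trans hn; apply: ler_pM => //.
  by apply: half_exp_decr; exact: leqW.
apply: (@le_trans _ _ 1); first by case: (_ != _).
by apply: le_trans (pi_ge2 R); rewrite ler1n.
Qed.

Lemma measurable_path_open (U : set (path_space Gamma)) :
  path_open U -> measurable U.
Proof. exact: sub_gen_smallest. Qed.

Lemma path_open_Pi_finite r (V : set R[i]^o) :
  open V -> path_open (Pi r @^-1` (Some @` V)).
Proof.
move=> oV x [z Vz zx].
have [a a0 aV] := open_contains_normc_ball oV Vz.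
have [e e0 eP] := sphere_ball_finite z a0.
exists (2 ^- r * e); first by rewrite mulr_gt0// half_exp_gt0.
move=> y /(le_lt_trans (path_dist_ge_point x y r)).
rewrite ltr_pM2l ?half_exp_gt0// -zx => /eP[w yw zw].
by exists w => //; exact: aV.
Qed.

(** Only the finite part of an open set needs the metric; the point at infinity
    is treated as the complement of the open set of finite points. *)
Lemma measurable_Pi r (B : set (sphere R)) :
  measurable B -> measurable (Pi r @^-1` B).
Proof.
have mS (V : set R[i]^o) : open V -> measurable (Pi r @^-1` (Some @` V)).
  by move=> oV; apply: measurable_path_open; exact: path_open_Pi_finite.
have mN : measurable (Pi r @^-1` [set None]).
  rewrite (_ : _ @^-1` _ = ~` (Pi r @^-1` (Some @` [set: R[i]^o]))).
    by apply: measurableC; apply: mS; exact: openT.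
  apply/seteqP; split => x /=; first by move=> xN [z _]; rewrite xN.
  by case: (Pi r x) => // z h; exfalso; apply: h; exists z.
move=> mB; rewrite -[X in measurable X]setTI.
suff : measurable_fun setT (Pi r) by apply.
apply: (@measurability _ _ _ _ _ _ (@open (sphere R))) => // _ [U oU <-].
rewrite setTI.
have oV : open ((Some : R[i]^o -> sphere R) @^-1` U).
  by apply: open_comp => // x _; exact: one_point_compactification_some_continuous.
have [UN|UN] := pselect (U None).
  rewrite (_ : U = (Some @` (Some @^-1` U)) `|` [set None]).
    by rewrite preimage_setU; apply: measurableU => //; exact: mS.
  apply/seteqP; split; last by move=> _ [[z Uz <-//]|->].
  by move=> [z Uz|_]; [left; exists z|right].
rewrite (_ : U = Some @` (Some @^-1` U)); first exact: mS.
apply/seteqP; split; last by move=> _ [z Uz <-].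
by move=> [z Uz|//]; exists z.
Qed.

Lemma measurable_Proj r t : measurable (Proj r.+1 @^-1` [set t]).
Proof.
apply: measurable_path_open => x xt; exists (2 ^- r.+1); first exact: half_exp_gt0.
move=> y; rewrite ltNge => /negP xy; rewrite /= -xt; apply/esym/eqP.
by apply/negP => /negP /path_dist_ge_label.
Qed.

Definition coordinate_set : set (set (path_space Gamma)) :=
  [set A | (exists2 B, measurable B & A = Pi 0 @^-1` B) \/
           exists t, A = Proj 1 @^-1` [set t]].

Lemma coordinate_set_measurable : coordinate_set `<=` measurable.
Proof.
by move=> A [[B mB ->]|[t ->]]; [exact: measurable_Pi|exact: measurable_Proj].
Qed.

Definition cylinder_set : set (set (path_space Gamma)) :=
  [set A | exists p B, coordinate_set B /\ A = iter p shift @^-1` B].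

(** There are countably many finite sequences of pairs of a set of the countable
    family and a label, and an open set is the union of the corresponding
    sets of paths that it contains. *)
Lemma path_open_generated_cylinder U : path_open U -> <<s cylinder_set >> U.
Proof.
move=> oU; pose W := g_sigma_algebraType cylinder_set.
pose t0 := Ordinal (correspondence_gt0 Gamma).
pose keyT := (option (rat * rat * nat) * 'I_M)%type.
pose C (s : seq keyT) : set W := [set x | forall r, (r < size s)%N ->
  base_set (nth (None, t0) s r).1 (Pi r x) /\ Proj r.+1 x = (nth (None, t0) s r).2].
have mC s : measurable (C s).
  rewrite (_ : C s = \bigcap_(r in `I_(size s))
     ((Pi r @^-1` base_set (nth (None, t0) s r).1) `&`
      (Proj r.+1 @^-1` [set (nth (None, t0) s r).2]))); last first.
    by apply/seteqP; split => x h r /h.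
  apply: bigcap_measurableType.
  move=> r _; apply: measurableI; apply: sub_gen_smallest.
    exists r, (Pi 0 @^-1` base_set (nth (None, t0) s r).1); split.
      left; exists (base_set (nth (None, t0) s r).1) => //.
      exact: measurable_base_set.
    by apply/seteqP; split => x; rewrite /= Pi_iter_shift.
  exists r, (Proj 1 @^-1` [set (nth (None, t0) s r).2]); split.
    by right; exists (nth (None, t0) s r).2.
  by apply/seteqP; split => x; rewrite /= Proj_iter_shift.
pose F (o : option (seq keyT)) : set W :=
  match o with Some s => if `[< C s `<=` U >] then C s else set0 | None => set0 end.
have mF o : measurable (F o).
  case: o => [s|]; last exact: measurable0.
  by rewrite /F; case: `[< _ >]; [exact: mC|exact: measurable0].
suff -> : U = \bigcup_n F (unpickle n).
  by apply: (@bigcupT_measurable _ W) => n; exact: mF.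
apply/seteqP; split; last first.
  move=> x [n _]; case: (unpickle n) => // s; rewrite /F.
  by case: ifPn => // /asboolP; exact.
move=> x /oU[e e0 eU]; have e20 : 0 < e / 2 by rewrite divr_gt0.
have [N Npi] : exists N, 2 ^- N * pi <= e / 2 :> R.
  have := near_infty_natSinv_expn_lt (PosNum (divr_gt0 e20 (pi_gt0 R))).
  move=> [N _ /(_ N (leqnn N))/=]; rewrite div1r ltr_pdivlMr ?pi_gt0// => /ltW.
  by exists N.
have /choice[k kP] := fun r => base_set_small (Pi r x) e20.
pose s : seq keyT := mkseq (fun r => (k r, Proj r.+1 x)) N.
exists (pickle s) => //; rewrite pickleK /F.
case: ifPn => [_|/asboolPn]; last first.
  move=> []; move=> y Csy; apply: eU; apply: (@le_lt_trans _ _ (e / 2)); last lra.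
  apply: (path_dist_le (n := N)) => // r rN.
    have := Csy r; rewrite size_mkseq => /(_ rN)[].
    by rewrite nth_mkseq//= => /((kP r).2) /ltW.
  by have := Csy r; rewrite size_mkseq => /(_ rN)[_]; rewrite nth_mkseq.
move=> r; rewrite size_mkseq => rN; rewrite nth_mkseq//=.
by split => //; exact: (kP r).1.
Qed.

Lemma measurable_generated_cylinder A : measurable A -> <<s cylinder_set >> A.
Proof.
apply: smallest_sub; last exact: path_open_generated_cylinder.
exact: smallest_sigma_algebra.
Qed.

Lemma measurable_shift A : measurable A -> measurable (shift @^-1` A).
Proof.
move=> /measurable_generated_cylinder.
suff : <<s cylinder_set >> `<=` [set A | measurable (shift @^-1` A)] by apply.
apply: smallest_sub.
  split; first by rewrite /= preimage_set0.
    by move=> B mB; rewrite /= setTD preimage_setC; exact: measurableC.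
  by move=> F mF; rewrite /= preimage_bigcup; apply: bigcupT_measurable.
move=> _ [p [B [[[B' mB' ->]|[t ->]] ->]]] /=.
  rewrite (_ : _ @^-1` _ = Pi p.+1 @^-1` B'); first exact: measurable_Pi.
  by apply/seteqP; split => x; rewrite /= -iterSr Pi_iter_shift.
rewrite (_ : _ @^-1` _ = Proj p.+2 @^-1` [set t]); first exact: measurable_Proj.
by apply/seteqP; split => x; rewrite /= -iterSr Proj_iter_shift.
Qed.
End paths.

(** * Measurability for the completion of a probability *)

Section outer.
Context (d : measure_display) (T : measurableType d) (R : realType).
Variable nu : probability T R.
Local Open Scope ereal_scope.
Local Notation "nu ^*" := (mu_ext nu).

Lemma mu_ext_fin_num (E : set T) : nu^* E \is a fin_num.
Proof.
rewrite ge0_fin_numE; last exact: mu_ext_ge0.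
apply: le_lt_trans (ltry 1); rewrite -(probability_setT nu) -measurable_mu_extE//.
exact: le_mu_ext.
Qed.

(** The intersection of covers of [E] whose measures approach the outer
    measure. *)
Lemma measurable_hull (E : set T) :
  exists G, [/\ measurable G, E `<=` G & nu G = nu^* E].
Proof.
have cover (n : nat) : exists G, [/\ measurable G, E `<=` G &
    nu G <= nu^* E + n.+1%:R^-1%:E].
  have n0 : (0 < n.+1%:R^-1 :> R)%R by [].
  have [_ [A [mA EA] <-] h] := lb_ereal_inf_adherent n0 (mu_ext_fin_num E).
  exists (\bigcup_k A k); split => //; first exact: bigcupT_measurable.
  apply: le_trans (ltW h); apply: measure_sigma_subadditive => //.
  exact: bigcupT_measurable.
move: cover => /choice[G GP]; exists (\bigcap_n G n).
have mG : measurable (\bigcap_n G n).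
  by apply: bigcapT_measurable => n; case: (GP n).
have EG : E `<=` \bigcap_n G n.
  by move=> x Ex n _; case: (GP n) => _ /(_ _ Ex).
split => //; apply/eqP; rewrite eq_le; apply/andP; split; last first.
  by rewrite -measurable_mu_extE//; exact: le_mu_ext.
apply/lee_addgt0Pr => e e0.
have [n] := ltr_add_invr e0; rewrite add0r => ne.
have [mGn _ GnE] := GP n.
apply: (@le_trans _ _ (nu (G n))).
  by apply: le_measure; rewrite ?inE//; exact: bigcap_inf.
by apply: le_trans GnE _; rewrite leeD2l// lee_fin ltW.
Qed.

Lemma mu_ext0_negligible (E : set T) : nu^* E = 0 -> nu.-negligible E.
Proof. by have [G [mG EG GE]] := measurable_hull E; rewrite -GE; exists G. Qed.

Lemma negligible_mu_ext0 (E : set T) : nu.-negligible E -> nu^* E = 0.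
Proof.
move=> [N [mN N0 EN]]; apply/eqP; rewrite eq_le mu_ext_ge0// andbT -N0.
by rewrite -measurable_mu_extE//; exact: le_mu_ext.
Qed.

Lemma caratheodory_hull (E : set T) : nu^*.-cara.-measurable E ->
  exists G, [/\ measurable G, E `<=` G & nu.-negligible (G `\` E)].
Proof.
move=> cE; have [G [mG EG GE]] := measurable_hull E; exists G; split => //.
apply: mu_ext0_negligible.
have nuG : nu^* G = nu G := measurable_mu_extE nu mG.
have : nu^* G = nu^* (G `&` E) + nu^* (G `&` ~` E) := cE G.
rewrite (setIidr EG) -setDE nuG GE addeC => h.
have fE := mu_ext_fin_num E.
by have := congr1 (fun t => t - nu^* E) h; rewrite subee// addeK// => <-.
Qed.

Lemma mu_ext_ae_eq (A B : set T) : measurable B ->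
  nu.-negligible (A `+` B) -> nu^* A = nu B.
Proof.
move=> mB /negligible_mu_ext0 AB0; rewrite -measurable_mu_extE//.
have h (C D : set T) : nu^* (C `+` D) = 0 -> nu^* C <= nu^* D.
  move=> CD0; rewrite -[leRHS]adde0 -CD0.
  apply: le_trans (outer_measureU2 _ _ _); apply: le_mu_ext => x Cx.
  by have [Dx|nDx] := pselect (D x); [left|right; left].
by apply/eqP; rewrite eq_le !h// setYC.
Qed.

(** Each fibre differs from a measurable hull by a null set; off a measurable
    null set [N] containing these differences the fibres of [q] are
    measurable, and on [N] the map can be made constant. *)
Lemma ae_measurable_modification s (q : T -> 'I_s) :
  (forall i, nu^*.-cara.-measurable (q @^-1` [set i])) ->
  exists (q' : T -> 'I_s) (N : set T), [/\ fibre_measurable q',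
    measurable N, nu N = 0 & forall z, ~ N z -> q z = q' z].
Proof.
move=> cq; have /choice[G GP] := fun i => caratheodory_hull (cq i).
have [N [mN N0 GN]] : nu.-negligible
    (\bigcup_k (if insub k is Some i then G i `\` (q @^-1` [set i]) else set0)).
  apply: negligible_bigcup => k; case: insubP => [i _ _|_].
    by case: (GP i).
  exact: negligible_set0.
pose q' z := if `[< N z >] then q point else q z.
exists q', N; split => //; last by move=> z Nz; rewrite /q'; case: asboolP.
move=> i; rewrite (_ : _ @^-1` _ = (G i `\` N) `|`
    (if q point == i then N else set0)).
  apply: measurableU; last by case: ifP.
  by apply: measurableD => //; case: (GP i).
apply/seteqP; split => z /=; rewrite /q'.
  case: asboolP => [Nz /eqP -> |nNz qz]; first by right.
  by left; split => //; case: (GP i) => _ + _; exact.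
case=> [[Gz nNz]|].
  case: asboolP => // _; apply: contrapT => qz; apply: nNz; apply: GN.
  by exists (i : nat) => //; rewrite valK; split.
by case: eqP => // qi Nz; case: asboolP.
Qed.
End outer.

(** * Kolmogorov-Sinai entropy as a supremum of rates *)

Section ks.
Context (d : measure_display) (T : measurableType d) (R : realType).
Variables (mu : probability T R) (f : T -> T).
Hypothesis f_measurable : forall A, measurable A -> measurable (f @^-1` A).
Hypothesis f_invariant : invariant_measure f mu.

Lemma partition_fibres (S I : Type) (meas : set (set S)) (A : I -> set S) :
  finite_partition meas A -> exists X : S -> I, A = fun i => X @^-1` [set i].
Proof.
move=> [_ tA cA]; have /choice[X XA] : forall x, exists i, A i x.
  by move=> x; have [i _ Aix] : (\bigcup_i A i) x; [rewrite cA|exists i].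
exists X; apply/funext => i; apply/seteqP; split => x /=; last by move=> <-.
by move=> Ax; apply: (tA (X x) i) => //; exists x.
Qed.

Lemma fibres_partition (S I : Type) (meas : set (set S)) (X : S -> I) :
  (forall i, meas (X @^-1` [set i])) ->
  finite_partition meas (fun i => X @^-1` [set i]).
Proof.
move=> mX; split => //; first by move=> i j _ _ [x [/= <- <-]].
by apply/seteqP; split => // x _; exists (X x).
Qed.

(** The index set [I] is numbered, which changes neither the fibres nor the
    rate. *)
Lemma rate_le_ks_entropy (I : finType) (X : T -> I) : fibre_measurable X ->
  ((rate mu f X)%:E <= ks_entropy f mu)%E.
Proof.
move=> mX; pose Y := enum_rank \o X.
have XY : determines X Y by move=> x y e; rewrite /Y /= e.
have mY := fibre_measurable_determines XY mX.
apply: (@le_trans _ _ (rate mu f Y)%:E).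
  rewrite lee_fin; apply: (rate_le_determines f_measurable f_invariant mY).
  by move=> x y /enum_rank_inj.
rewrite -(entropy_rateE f_measurable f_invariant mY).
apply: ereal_sup_ubound; exists #|I|, (fun i => Y @^-1` [set i]); split => //.
exact: fibres_partition.
Qed.

Lemma ks_entropy_le (b : \bar R) :
  (forall s (X : T -> 'I_s), fibre_measurable X -> ((rate mu f X)%:E <= b)%E) ->
  (ks_entropy f mu <= b)%E.
Proof.
move=> h; apply: ge_ereal_sup => _ [s [A [pA ->]]].
have [X AX] := partition_fibres pA.
have mX : fibre_measurable X by move=> i; case: pA => + _ _ => /(_ i); rewrite AX.
by rewrite AX entropy_rateE//; exact: h.
Qed.
End ks.

(** * Intermediate entropy *)

Section main.
Variables (R : realType) (M : nat) (Gamma : correspondence R M).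
Variables (nu : probability (sphere R) R) (mu : probability (path_space Gamma) R).
Hypothesis mu_inv : invariant_measure (@path_shift R M Gamma) mu.
Hypothesis nu_mu : projects_to mu nu.
Local Notation shift := (@path_shift R M Gamma).
Local Notation Pi := (@Pi R M Gamma).
Local Notation Proj := (@Proj R M Gamma).

Definition first_step (I : finType) (q : sphere R -> I) :
    path_space Gamma -> I * 'I_M :=
  joint (q \o Pi 0) (Proj 1).

Lemma fibre_measurable_first_step (I : finType) (q : sphere R -> I) :
  fibre_measurable q -> fibre_measurable (first_step q).
Proof.
move=> mq; apply: fibre_measurable_joint; last exact: measurable_Proj.
by move=> i; rewrite comp_preimage; apply: measurable_Pi; exact: mq.
Qed.

(** By invariance every coordinate of a path has the distribution [nu]. *)
Lemma Pi_negligible N p : measurable N -> nu N = 0%E ->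
  mu.-negligible (Pi p @^-1` N).
Proof.
move=> mN N0; exists (Pi p @^-1` N); split => //; first exact: measurable_Pi.
rewrite (_ : _ @^-1` _ = iter p shift @^-1` (Pi 0 @^-1` N)); last first.
  by apply/seteqP; split => x; rewrite /= Pi_iter_shift.
transitivity (mu (Pi 0 @^-1` N)); last by rewrite -N0 nu_mu.
elim: p => // p <-; rewrite -[RHS]mu_inv.
  by congr (mu _); apply/seteqP; split => x; rewrite /= -iterSr.
by apply: (measurable_iter (@measurable_shift _ _ _)); exact: measurable_Pi.
Qed.

(** Off the null set of paths that visit [N] at some time, the cells of the
    joins built from [q] are those built from [q']; they thus have the same
    outer measure. *)
Lemma intermediate_entropy_partitionE s (q q' : sphere R -> 'I_s)
    (N : set (sphere R)) :
  fibre_measurable q' -> measurable N -> nu N = 0%E ->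
  (forall z, ~ N z -> q z = q' z) ->
  intermediate_entropy_partition mu (fun i => q @^-1` [set i]) =
  (rate mu shift (first_step q'))%:E.
Proof.
move=> mq' mN N0 qq'; have mP := fibre_measurable_first_step mq'.
rewrite -(entropy_rateE (@measurable_shift _ _ _) mu_inv mP).
rewrite /intermediate_entropy_partition /entropy_rate; congr (limn _).
apply/funext => n; congr (_ * _)%:E.
rewrite (entropy_itinerary _ _ (first_step q')).
rewrite map_entropyE; congr (- _); apply: eq_bigr => g _.
suff -> : (mu_ext mu) (iter_join (fun p it => (Pi p @^-1` (q @^-1` [set it.1])) `&`
    (Proj p.+1 @^-1` [set it.2])) g) =
  mu (itinerary shift n (first_step q') @^-1` [set g]) by [].
apply: mu_ext_ae_eq.
  exact: (fibre_measurable_itinerary (@measurable_shift _ _ _)).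
have : mu.-negligible (\bigcup_p (Pi p @^-1` N)).
  by apply: negligible_bigcup => p; exact: Pi_negligible.
apply: negligibleS => x xg; apply: contrapT => xN.
have xq p : q (Pi p x) = q' (Pi p x) by apply: qq' => h; apply: xN; exists p.
have xE : iter_join (fun p it => (Pi p @^-1` (q @^-1` [set it.1])) `&`
    (Proj p.+1 @^-1` [set it.2])) g x <-> itinerary shift n (first_step q') x = g.
  have PE p : first_step q' (iter p shift x) = (q (Pi p x), Proj p.+1 x).
    by rewrite /first_step /joint /= Pi_iter_shift Proj_iter_shift !add0n xq.
  split.
    move=> h; apply/ffunP => p.
    rewrite ffunE -[LHS]/(first_step q' (iter p shift x)) PE.
    by have [/= -> ->] := h p I; rewrite -surjective_pairing.
  by move=> <- p _; rewrite ffunE -[(_ \o _) x]/(first_step q' (iter p shift x)) PE.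
by case: xg => -[]; rewrite /= xE.
Qed.

Lemma intermediate_entropy_le :
  (intermediate_entropy nu mu <= ks_entropy shift mu)%E.
Proof.
apply: ge_ereal_sup => _ [s [Q [pQ ->]]].
have [q Qq] := partition_fibres pQ; subst Q.
case: pQ => cq _ _.
have [q' [N [mq' mN N0 qq']]] := ae_measurable_modification cq.
rewrite (intermediate_entropy_partitionE mq' mN N0 qq').
apply: rate_le_ks_entropy => //; first exact: measurable_shift.
exact: fibre_measurable_first_step.
Qed.

Lemma rate_first_step_le (I : finType) (q : sphere R -> I) :
  fibre_measurable q ->
  ((rate mu shift (first_step q))%:E <= intermediate_entropy nu mu)%E.
Proof.
move=> mq; pose q' := enum_rank \o q.
have qq' : determines q q' by move=> x y e; rewrite /q' /= e.
have mq' := fibre_measurable_determines qq' mq.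
apply: (@le_trans _ _ (rate mu shift (first_step q'))%:E).
  rewrite lee_fin; apply: (rate_le_determines (@measurable_shift _ _ _) mu_inv).
    exact: fibre_measurable_first_step.
  by move=> x y [/enum_rank_inj e1 e2]; congr (_, _).
rewrite -(@intermediate_entropy_partitionE _ q' q' set0 mq' measurable0
  (measure0 nu))//.
apply: ereal_sup_ubound; exists #|I|, (fun i => q' @^-1` [set i]); split => //.
apply: fibres_partition => i; apply: sub_caratheodory.
by apply: sub_gen_smallest; exact: mq'.
Qed.

(** Each of the finitely many coordinate sets given by the generator theorem
    prescribes either the first label or a Borel set for the first point. With
    [q] recording the membership in these Borel sets, [first_step q]
    determines all of them. *)
Lemma ks_entropy_le_intermediate :
  (ks_entropy shift mu <= intermediate_entropy nu mu)%E.
Proof.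
apply: (ks_entropy_le (@measurable_shift _ _ _) mu_inv) => s X mX.
apply/lee_addgt0Pr => e e0.
have [Bs [cBs Xe]] := rate_le_membership (@measurable_shift _ _ _) mu_inv
  (@coordinate_set_measurable _ _ Gamma)
  (@measurable_generated_cylinder _ _ Gamma) mX e0.
have /choice[U UP] : forall B : set (path_space Gamma), exists U : set (sphere R),
    measurable U /\ (coordinate_set B ->
      B = Pi 0 @^-1` U \/ exists t, B = Proj 1 @^-1` [set t]).
  move=> B; have [[[U mU ->]|Bt]|nB] := pselect (coordinate_set B).
  - by exists U; split => // _; left.
  - by exists set0; split => // _; right.
  - by exists set0; split.
pose Us := [seq U B | B <- Bs].
have mq : fibre_measurable (membership Us).
  apply: (fibre_measurable_membership (G := measurable)) => // _ /mapP[B _ ->].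
  by case: (UP B).
apply: (@le_trans _ _
  ((rate mu shift (first_step (membership Us)))%:E + e%:E)%E); last first.
  by rewrite leeD2r//; exact: rate_first_step_le.
rewrite -EFinD lee_fin; apply: le_trans Xe _; rewrite lerD2r.
apply: (rate_le_determines (@measurable_shift _ _ _) mu_inv).
  exact: fibre_measurable_first_step.
move=> x y [/membership_eqP eU eP]; apply/membership_eqP => B BBs.
have [_ /(_ (cBs _ BBs))[->|[t ->]]] := UP B; last by rewrite /= eP.
by rewrite /=; apply: eU; exact: map_f.
Qed.
End main.

Theorem theorem4p1 (R : realType) (M : nat) (Gamma : correspondence R M)
    (nu : probability (sphere R) R)
    (mu : probability (path_space Gamma) R)
    (nuS : S_Gamma Gamma nu)
    (mu_inv : invariant_measure (@path_shift R M Gamma) mu)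
    (nu_mu : projects_to mu nu) :
  intermediate_entropy nu mu = ks_entropy (@path_shift R M Gamma) mu.
Proof.
apply/eqP; rewrite eq_le; apply/andP; split.
  exact: intermediate_entropy_le.
exact: ks_entropy_le_intermediate.
Qed.
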